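(* (i) For $n\ge2$, every nonempty shell of $\mathbb Z^n$ and of $\mathrm{Sh}(\mathbb Z^n)$ is a spherical $3$-design. (ii) The following shells are spherical $3\tfrac12$-designs: every nonempty shell of $\mathbb Z^2$ and of $\mathrm{Sh}(\mathbb Z^2)$; $(\mathbb Z^{16})_m$ for $m=2\cdot4^a$, $a\ge0$; $\mathrm{Sh}(\mathbb Z^{16})_m$ for $m=2\cdot4^a$, $a\ge1$; $\mathrm{Sh}(\mathbb Z^{40})_{24}$. (iii) The following shells are spherical $5$-designs: $(\mathbb Z^4)_m$ for $m=2a$, $a\ge1$; $(\mathbb Z^7)_m$ for $m=4^a(8b+3)$, $a,b\ge0$; $\mathrm{Sh}(\mathbb Z^{16})_m$ for $m=4a+2$, $a\ge1$.
   Context: $\mathbb Z^n\subset\mathbb R^n$ is the cubic lattice; its shadow is $\mathrm{Sh}(\mathbb Z^n)=(\mathbb Z+\tfrac12)^n$. For $A\subset\mathbb R^n$, the shell of norm $m$ is $A_m=\{x\in A:\langle x,x\rangle=m\}$. Spherical designs (all sets here are antipodal, $X=-X$): for a nonempty finite antipodal $X$ on a sphere centred at $0$ and $j\ge1$, condition $(C_{2j})$ means $\sum_{x\in X}P(x)=0$ for every homogeneous harmonic polynomial $P$ of degree $2j$ on $\mathbb R^n$. $X$ is a spherical $t$-design ($t$ a positive integer) iff $(C_{2j})$ holds for all $2\le 2j\le t$. $X$ is a spherical $(2s+1+\tfrac12)$-design iff $(C_{2j})$ holds for all $2\le2j\le2s$ and for $2j=2s+4$; thus a $3\tfrac12$-design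 satisfies $(C_2)$ and $(C_6)$. *)

(* Defs.v *)
From HB Require Import structures.
From mathcomp Require Import all_boot all_order all_algebra.
From mathcomp Require Import reals.
From mathcomp Require Import mpoly.

Set Implicit Arguments.
Unset Strict Implicit.
Unset Printing Implicit Defensive.

Import Order.TTheory GRing.Theory Num.Theory.
Local Open Scope ring_scope.

Section Defs.
Variable R : realType.

Definition sqnorm n (x : 'rV[R]_n) : R := \sum_(i < n) x 0 i ^+ 2.

Definition evalp n (P : {mpoly R[n]}) (x : 'rV[R]_n) : R :=
  P.@[fun i => x 0 i].

Definition laplacian n (P : {mpoly R[n]}) : {mpoly R[n]} :=
  \sum_(i < n) mderiv i (mderiv i P).

Definition harmonic n (P : {mpoly R[n]}) : bool := laplacian P == 0.

(* Condition (C_{2j}) for a finite set X (given as a duplicate-free list):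
   sum of P over X vanishes for every homogeneous harmonic P of degree 2j. *)
Definition cond_C n (X : seq 'rV[R]_n) (k : nat) : Prop :=
  forall P : {mpoly R[n]}, P \is k.-homog -> harmonic P ->
    \sum_(x <- X) evalp P x = 0.

Definition sph_design n (X : seq 'rV[R]_n) (t : nat) : Prop :=
  X != [::] /\ forall j : nat, (1 <= j)%N -> (j.*2 <= t)%N -> cond_C X j.*2.

(* Spherical (2s+1+1/2)-design: (C_2j) for 2 <= 2j <= 2s, and (C_{2s+4}). *)
Definition sph_design_half n (X : seq 'rV[R]_n) (s : nat) : Prop :=
  X != [::] /\
  (forall j : nat, (1 <= j)%N -> (j <= s)%N -> cond_C X j.*2) /\
  cond_C X (2 * s + 4)%N.

(* Bound on coordinates of a point of norm m: |x_i| <= sqrt m <= B. *)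
Definition box_bound (m : R) : nat := (Num.truncn m).+1.

(* The shell (Z^n)_m: all integer vectors x with <x,x> = m.
   Integer vectors in the box [-B, B]^n are enumerated injectively via
   k : {ffun 'I_n -> 'I_(2B+1)}, x_i = k_i - B; the box contains the shell. *)
Definition shellZ n (m : R) : seq 'rV[R]_n :=
  let B := box_bound m in
  [seq x <- [seq \row_(i < n) ((k i)%:R - B%:R) | k : {ffun 'I_n -> 'I_(B.*2.+1)}]
     | sqnorm x == m].

(* The shell Sh(Z^n)_m of the shadow (Z + 1/2)^n: x_i = k_i - B - 1/2 with
   k_i in {0, ..., 2B+1}, i.e. x_i ranges over -B-1/2, ..., B+1/2. *)
Definition shellSh n (m : R) : seq 'rV[R]_n :=
  let B := box_bound m in
  [seq x <- [seq \row_(i < n) ((k i)%:R - B%:R - 2^-1)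
              | k : {ffun 'I_n -> 'I_(B.*2.+2)}]
     | sqnorm x == m].

End Defs.

(* Main.v *)
Require Import Defs.
From HB Require Import structures.
From mathcomp Require Import all_boot all_order all_algebra.
From mathcomp Require Import boolp reals.
From mathcomp Require Import ssrcomplements mpoly.
From mathcomp Require Import ring zify.

Import Order.TTheory GRing.Theory Num.Theory.
Local Open Scope ring_scope.

(* Put [A] and [B] for the sums of [x ^ (y ^ 2)] over the even and over the odd
   integers [y], so that [A ^ n] and [B ^ n] count the vectors of the doubled
   lattice and of its doubled shadow by their norm. The theta series of a
   harmonic [P] of degree 2, 4 or 6 is computed by Gaussian integration by
   parts: the Laplacian takes care of the Gaussian part, and what remains is a
   multiple of the fourth or sixth cumulant of one coordinate, a differential
   polynomial in [A] or [B].

   Rotating the plane by 45 degrees gives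
   [A(x)^2 = A(x^2)^2 + B(x^2)^2] and [B(x)^2 = 2 A(x^2) B(x^2)]. A relation
   between a series at [x] and at [x^2] determines the series, and this turns
   the two formulas into product formulas for the cumulants, e.g. the degree 4
   theta series of [Z^n] is a multiple of [A^n B^4 (A^4 - B^4)]. Expanding such
   a product again at [x^2] and at [x^4], and sorting exponents modulo 4 ([A]
   lives on exponents 0 mod 4, [B] on exponents 1 mod 8), shows that the
   required coefficients vanish. Shells are nonempty by Lagrange's theorem. *)

(** * Formal power series *)

Record ps (R : Type) := PS { psc : nat -> R }.
Arguments PS {R}.
Arguments psc {R}.

HB.instance Definition _ R := gen_eqMixin (ps R).
HB.instance Definition _ R := gen_choiceMixin (ps R).

Lemma psP R (s t : ps R) : psc s =1 psc t -> s = t.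
Proof. by case: s t => [s] [t] /= /funext ->. Qed.

Section PsRing.
Context {R : comNzRingType}.
Implicit Types s t u : ps R.

Definition ps_trunc (N : nat) s : {poly R} := \poly_(i < N.+1) psc s i.

Definition psC (c : R) : ps R := PS (fun N => c *+ (N == 0%N)).
Definition ps_add s t := PS (fun N => psc s N + psc t N).
Definition ps_opp s := PS (fun N => - psc s N).
Definition ps_mul s t := PS (fun N => \sum_(i < N.+1) psc s i * psc t (N - i)%N).

Lemma coef_ps_trunc N s i : (i <= N)%N -> (ps_trunc N s)`_i = psc s i.
Proof. by move=> leiN; rewrite coef_poly ltnS leiN. Qed.

(** Only coefficients of index at most [i] enter the [i]-th coefficient of a product. Hence
    associativity and commutativity of the product of series can be read off from truncations in
    [{poly R}]. *)
Lemma psc_mul_trunc N s t (p q : {poly R}) :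
    (forall i, (i <= N)%N -> p`_i = psc s i) ->
    (forall i, (i <= N)%N -> q`_i = psc t i) ->
  forall i, (i <= N)%N -> (p * q)`_i = psc (ps_mul s t) i.
Proof.
move=> eps eqt i leiN; rewrite coefM; apply: eq_bigr => j _.
by rewrite eps ?eqt //; move: (ltn_ord j); lia.
Qed.

Lemma ps_addA : associative ps_add.
Proof. by move=> s t u; apply/psP => N /=; rewrite addrA. Qed.
Lemma ps_addC : commutative ps_add.
Proof. by move=> s t; apply/psP => N /=; rewrite addrC. Qed.
Lemma ps_add0 : left_id (psC 0) ps_add.
Proof. by move=> s; apply/psP => N /=; rewrite mul0rn add0r. Qed.
Lemma ps_addN : left_inverse (psC 0) ps_opp ps_add.
Proof. by move=> s; apply/psP => N /=; rewrite mul0rn addNr. Qed.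

HB.instance Definition _ :=
  GRing.isZmodule.Build (ps R) ps_addA ps_addC ps_add0 ps_addN.

Lemma ps_mulA : associative ps_mul.
Proof.
move=> s t u; apply/psP => N.
have tr r := coef_ps_trunc N r.
have trM r r' := psc_mul_trunc N r r' _ _ (tr r) (tr r').
rewrite -(psc_mul_trunc N _ _ _ _ (tr s) (trM t u)) //.
by rewrite -(psc_mul_trunc N _ _ _ _ (trM s t) (tr u)) // mulrA.
Qed.

Lemma ps_mulC : commutative ps_mul.
Proof.
move=> s t; apply/psP => N; have tr r := coef_ps_trunc N r.
rewrite -(psc_mul_trunc N _ _ _ _ (tr s) (tr t)) //.
by rewrite -(psc_mul_trunc N _ _ _ _ (tr t) (tr s)) // mulrC.
Qed.

Lemma ps_mul1 : left_id (psC 1) ps_mul.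
Proof.
move=> s; apply/psP => N /=.
by rewrite big_ord_recl big1 /= ?subn0 ?mul1r ?addr0 // => i _; rewrite mul0r.
Qed.

Lemma ps_mulDl : left_distributive ps_mul ps_add.
Proof.
by move=> s t u; apply/psP => N /=; rewrite -big_split; apply: eq_bigr => i _; rewrite mulrDl.
Qed.

Lemma ps_oner_neq0 : psC 1 != psC 0.
Proof.
by apply/eqP => /(congr1 (fun s => psc s 0)) /= /eqP; rewrite oner_eq0.
Qed.

HB.instance Definition _ := GRing.Zmodule_isComNzRing.Build (ps R)
  ps_mulA ps_mulC ps_mul1 ps_mulDl ps_oner_neq0.

Lemma pscD s t N : psc (s + t) N = psc s N + psc t N. Proof. by []. Qed.
Lemma pscN s N : psc (- s) N = - psc s N. Proof. by []. Qed.
Lemma psc0 N : psc (0 : ps R) N = 0. Proof. exact: mul0rn. Qed.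
Lemma psc1 N : psc (1 : ps R) N = (N == 0%N)%:R. Proof. by []. Qed.
Lemma pscM s t N : psc (s * t) N = \sum_(i < N.+1) psc s i * psc t (N - i)%N.
Proof. by []. Qed.

Lemma pscM0 s t : psc (s * t) 0 = psc s 0 * psc t 0.
Proof. by rewrite pscM big_ord1. Qed.

Lemma pscX0 s k : psc (s ^+ k) 0 = psc s 0 ^+ k.
Proof. by elim: k => [|k IH]; rewrite ?psc1 // !exprS pscM0 IH. Qed.

Lemma pscM1 s t : psc s 0 = 0 -> psc (s * t) 1 = psc s 1 * psc t 0.
Proof. by move=> s0; rewrite pscM big_ord_recl big_ord1 s0 mul0r add0r. Qed.

Lemma pscMn s k N : psc (s *+ k) N = psc s N *+ k.
Proof. by elim: k => [|k IH]; rewrite ?mulr0n ?psc0 // !mulrS pscD IH. Qed.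

Lemma psc_sum I (r : seq I) (P : pred I) (F : I -> ps R) N :
  psc (\sum_(i <- r | P i) F i) N = \sum_(i <- r | P i) psc (F i) N.
Proof. by elim/big_rec2: _ => [|i x y _ <-]; rewrite ?psc0. Qed.

Lemma psc_prod_trunc (I : finType) (s : I -> ps R) (p : I -> {poly R}) N :
    (forall k i, (i <= N)%N -> (p k)`_i = psc (s k) i) ->
  forall i, (i <= N)%N -> (\prod_k p k)`_i = psc (\prod_k s k) i.
Proof.
move=> eps; elim/big_rec2: _ => [i _|k t q _ IH i]; first by rewrite coef1 psc1.
exact: (psc_mul_trunc N _ _ _ _ (eps k) IH).
Qed.

Lemma psC_is_zmod_morphism : zmod_morphism psC.
Proof. by move=> c d; apply/psP => N /=; rewrite mulrnBl. Qed.
Lemma psC_is_monoid_morphism : monoid_morphism psC.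
Proof.
split=> // c d; apply/psP => -[|N].
  by rewrite pscM big_ord_recl big_ord0 addr0 /= !mulr1n.
rewrite pscM big_ord_recl big1 ?addr0 /= ?mulr0n ?mulr0 // => i _.
by rewrite ?mulr0n mul0r.
Qed.
HB.instance Definition _ :=
  GRing.isZmodMorphism.Build R (ps R) psC psC_is_zmod_morphism.
HB.instance Definition _ :=
  GRing.isMonoidMorphism.Build R (ps R) psC psC_is_monoid_morphism.

Lemma pscCM c s N : psc (psC c * s) N = c * psc s N.
Proof.
rewrite pscM big_ord_recl big1 ?addr0 /= ?mulr1n ?subn0 // => i _.
by rewrite ?mulr0n mul0r.
Qed.

Lemma pscnM k s N : psc (k%:R * s) N = k%:R * psc s N.
Proof. by rewrite mulr_natl pscMn mulr_natl. Qed.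

(** * The substitution [x -> x ^+ 2] and the derivation [x d/dx] *)

Definition dil s : ps R := PS (fun N => if odd N then 0 else psc s N./2).

Lemma psc_dil s N : psc (dil s) N = if odd N then 0 else psc s N./2.
Proof. by []. Qed.

Lemma dil_is_zmod_morphism : zmod_morphism dil.
Proof. by move=> s t; apply/psP => N /=; case: ifP; rewrite ?subr0. Qed.

Lemma dil_is_monoid_morphism : monoid_morphism dil.
Proof.
split; first by apply/psP => -[|[|N]] //=; case: ifP.
move=> s t; apply/psP => N; rewrite pscM /=.
pose F i := psc (dil s) i * psc (dil t) (N - i)%N.
rewrite -(big_mkord xpredT F) /=.
have F_odd i : odd i -> F i = 0 by rewrite /F /= => ->; rewrite mul0r.
(* The odd indices drop out of the convolution, because [dil s] has no odd coefficients. *)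
have pairs k : \sum_(0 <= i < k.*2.+1) F i = \sum_(i < k.+1) F i.*2.
  elim: k => [|k IH]; first by rewrite double0 big_nat1 big_ord1.
  rewrite doubleS big_nat_recr // big_nat_recr //= IH.
  by rewrite (F_odd k.*2.+1) ?addr0 /= ?odd_double // [RHS]big_ord_recr.
have [oddN|evN] := boolP (odd N).
  rewrite big_nat_cond big1 // => i /andP[/andP[_ lti] _]; rewrite /F /=.
  have [oi|ei] := boolP (odd i); first by rewrite mul0r.
  by rewrite oddB ?oddN ?(negbTE ei) ?mulr0 //; lia.
transitivity (\sum_(0 <= i < N./2.*2.+1) F i); last by rewrite even_halfK.
rewrite pairs; apply: eq_bigr => i _; rewrite /F /= odd_double doubleK.
move: (ltn_ord i) => lti; rewrite oddB; last by lia.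
rewrite odd_double (negbTE evN) /=; congr (_ * psc t _); lia.
Qed.
HB.instance Definition _ :=
  GRing.isZmodMorphism.Build (ps R) (ps R) dil dil_is_zmod_morphism.
HB.instance Definition _ :=
  GRing.isMonoidMorphism.Build (ps R) (ps R) dil dil_is_monoid_morphism.

Lemma psc_dil_double s N : psc (dil s) N.*2 = psc s N.
Proof. by rewrite /= odd_double doubleK. Qed.

Definition psD s : ps R := PS (fun N => psc s N *+ N).

Lemma psc_D s N : psc (psD s) N = psc s N *+ N. Proof. by []. Qed.

Lemma psD_is_zmod_morphism : zmod_morphism psD.
Proof. by move=> s t; apply/psP => N /=; rewrite mulrnBl. Qed.
HB.instance Definition _ :=
  GRing.isZmodMorphism.Build (ps R) (ps R) psD psD_is_zmod_morphism.

Lemma psDD s t : psD (s + t) = psD s + psD t. Proof. exact: raddfD. Qed.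
Lemma psDN s : psD (- s) = - psD s. Proof. exact: raddfN. Qed.
Lemma psDn k s : psD (k%:R * s) = k%:R * psD s.
Proof. by rewrite !mulr_natl raddfMn. Qed.

Lemma psDM s t : psD (s * t) = psD s * t + s * psD t.
Proof.
apply/psP => N; rewrite pscD psc_D !pscM -sumrMnl -big_split.
apply: eq_bigr => i _ /=; rewrite mulrnAl mulrnAr -mulrnDr.
by congr (_ *+ _); move: (ltn_ord i); lia.
Qed.

Lemma psD_dil s : psD (dil s) = 2 * dil (psD s).
Proof.
apply/psP => N; rewrite pscnM /=; case: ifP => [|/negbT/even_halfK eN].
  by rewrite mul0rn mulr0.
by rewrite mulr_natl -mulrnA muln2 eN.
Qed.

Lemma psDX s k : psD (s ^+ k.+1) = k.+1%:R * s ^+ k * psD s.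
Proof.
elim: k => [|k IH]; first by rewrite expr1 expr0; ring.
by rewrite exprS psDM IH !exprS -!natr1; ring.
Qed.

(** * Supports in residue classes *)

(** The residue [r] need not be reduced modulo [d], so residues simply add in [suppM] and get
    multiplied in [suppX]. *)
Definition supp (d r : nat) s := forall N, psc s N != 0 -> N = r %[mod d].

Lemma suppM d r r' s t : supp d r s -> supp d r' t -> supp d (r + r') (s * t).
Proof.
move=> Hs Ht N; apply: contraNeq => neqN; apply/eqP; rewrite pscM big1 // => i _.
apply/eqP; apply: contraNT neqN => nz.
have [/Hs si /Ht ti] : psc s i != 0 /\ psc t (N - i)%N != 0.
  by split; apply: contraNneq nz => ->; rewrite ?mulr0 ?mul0r.
by apply/eqP; rewrite -modnDm -si -ti modnDm subnKC // -ltnS.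
Qed.

Lemma suppD d r s t : supp d r s -> supp d r t -> supp d r (s + t).
Proof.
move=> Hs Ht N; rewrite pscD => nz; have [s0|/Hs //] := eqVneq (psc s N) 0.
by apply: Ht; rewrite s0 add0r in nz.
Qed.

Lemma suppN d r s : supp d r s -> supp d r (- s).
Proof. by move=> Hs N; rewrite pscN oppr_eq0; apply: Hs. Qed.

Lemma supp1 d : supp d 0 1.
Proof. by move=> [|N]; rewrite psc1 ?eqxx. Qed.

Lemma suppX d r s k : supp d r s -> supp d (r * k) (s ^+ k).
Proof.
move=> Hs; elim: k => [|k IH]; first by rewrite muln0; apply: supp1.
by rewrite exprS mulnS; apply: suppM.
Qed.

Lemma suppn d k : supp d 0 (k%:R).
Proof. by move=> N; rewrite -(mulr1 k%:R) pscnM; case: N => [//|N]; rewrite psc1 mulr0 eqxx. Qed.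

Lemma supp_eqmod d r r' s : r = r' %[mod d] -> supp d r s -> supp d r' s.
Proof. by move=> e Hs N /Hs ->. Qed.

Lemma supp_psc0 d r s N : supp d r s -> (N != r %[mod d]) -> psc s N = 0.
Proof. by move=> Hs; apply: contraNeq => /Hs ->. Qed.

End PsRing.

(** * Cancellation and fixed-point arguments over an integral domain *)

Section PsDomain.
Context {R : idomainType}.
Implicit Types s t u w y : ps R.

(** In any splitting of [v + k] other than [k + v], the index of [u] is below [k] or the index of
    [y] is below [v]. *)
Lemma psc_mul_low u y k v :
    (forall i, (i < k)%N -> psc u i = 0) -> (forall i, (i < v)%N -> psc y i = 0) ->
  psc (u * y) (v + k)%N = psc u k * psc y v.
Proof.
move=> u0 y0; rewrite pscM.
have ltk : (k < (v + k).+1)%N by lia.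
rewrite (bigD1 (Ordinal ltk)) //= big1 ?addr0 ?addnK // => i.
rewrite -val_eqE /= => neq; have [/u0->|geik] := ltnP i k; first by rewrite mul0r.
by rewrite (y0 (v + k - i)%N) ?mulr0 //; move: (ltn_ord i); lia.
Qed.

Lemma ps_mulI u y k :
    (forall i, (i < k)%N -> psc u i = 0) -> psc u k != 0 -> u * y = 0 -> y = 0.
Proof.
move=> u0 uk uy0; apply/psP => N; rewrite psc0.
elim/ltn_ind: N => v IH.
have := psc_mul_low u y k v u0 IH; rewrite uy0 psc0 => /esym/eqP.
by rewrite mulf_eq0 (negbTE uk) => /eqP.
Qed.

(* The right-hand side doubles valuations, the left-hand side only shifts
   them by [k]. *)
Lemma dil_fixpoint_eq0 u w y k :
    (forall i, (i < k)%N -> psc u i = 0) -> psc u k != 0 ->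
    (forall i, (i <= k)%N -> psc y i = 0) ->
  u * y = dil (w * y) -> y = 0.
Proof.
move=> u0 uk y0 uyE; apply/psP => N; rewrite psc0.
elim/ltn_ind: N => v IH; have [/y0//|ltkv] := leqP v k.
have := psc_mul_low u y k v u0 IH; rewrite uyE /=.
(* Since [k < v], half of [v + k] lies below [v], where [y] is already known to vanish. *)
have -> : (if odd (v + k) then 0 else psc (w * y) (v + k)./2) = 0.
  case: ifP => // _; rewrite pscM big1 // => i _.
  by rewrite (IH ((v + k)./2 - i)%N) ?mulr0 //; lia.
by move/esym/eqP; rewrite mulf_eq0 (negbTE uk) => /eqP.
Qed.

End PsDomain.

(** * Moments of the theta series of the even and of the odd integers *)

(* [win_elt e B k] for [k < win_size e B] runs through the integers of parity
   [e] in [[- B.*2 - e, B.*2 + e]]; halved, they are the coordinates that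
   [shellZ] ([e = false]) and [shellSh] ([e = true]) enumerate. *)
Definition win_size (e : bool) (B : nat) : nat := if e then B.*2.+2 else B.*2.+1.
Definition win_elt (e : bool) (B k : nat) : int := k.*2%:Z - (B.*2 + e)%:Z.
Definition win (e : bool) (B : nat) : seq int :=
  [seq win_elt e B k | k <- iota 0 (win_size e B)].

Lemma win_uniq e B : uniq (win e B).
Proof. rewrite map_inj_uniq ?iota_uniq // => j k; rewrite /win_elt; lia. Qed.

Lemma mem_win e B y :
  (y \in win e B) = (`|y| <= B.*2 + e)%N && (odd `|y| == e).
Proof.
apply/mapP/andP => [[k]|[ley /eqP oddy]].
  by rewrite mem_iota /win_size /win_elt => ltk ->; case: e ltk => /=; lia.
exists (absz (y + (B.*2 + e)%:Z))./2; rewrite ?mem_iota /win_size /win_elt.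
  by case: e ley oddy => /=; lia.
by case: e ley oddy => /=; lia.
Qed.

Lemma big_win {R : Type} {idx : R} (op : Monoid.law idx) e B (P : pred int) (F : int -> R) :
  \big[op/idx]_(y <- win e B | P y) F y =
  \big[op/idx]_(k < win_size e B | P (win_elt e B k)) F (win_elt e B k).
Proof. by rewrite /win big_map -{1}(subn0 (win_size e B)) big_mkord. Qed.

Section Moments.
Context {R : realFieldType}.

(** The [j]-th moment of the weights [x ^ (y ^ 2)] on the integers of parity [e]. As [|y| <= y ^ 2],
    the window [win e N] contains every [y] with [y ^ 2 = N]. *)
Definition mom (e : bool) (j : nat) : ps R :=
  PS (fun N => \sum_(y <- win e N | (`|y| ^ 2 == N)%N) y%:~R ^+ j).

Lemma psc_mom e j B N : (N <= B.*2 ^ 2)%N ->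
  psc (mom e j) N = \sum_(y <- win e B | (`|y| ^ 2 == N)%N) y%:~R ^+ j.
Proof.
move=> leN; rewrite /= -big_filter -[RHS]big_filter; apply: perm_big.
apply: uniq_perm; rewrite ?filter_uniq ?win_uniq // => y.
rewrite !mem_filter !mem_win; have [yN|//] := eqVneq (`|y| ^ 2)%N N.
have -> : (`|y| <= N.*2 + e)%N by rewrite -yN; nia.
by have -> : (`|y| <= B.*2 + e)%N by rewrite -yN leq_exp2r // in leN; lia.
Qed.

(** The derivation multiplies [x ^ (y ^ 2)] by [y ^ 2]. *)
Lemma psD_mom e j : psD (mom e j) = mom e j.+2.
Proof.
apply/psP => N; rewrite psc_D -sumrMnl; apply: eq_bigr => y /eqP yN.
rewrite -[in RHS]addn2 exprD -mulr_natr -yN; congr (_ * _).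
by rewrite natrX natr_absz intr_norm real_normK ?num_real.
Qed.

(** The terms of [y] and [- y] cancel. *)
Lemma mom_odd e j : odd j -> mom e j = 0.
Proof.
move=> oddj; apply/psP => N; rewrite psc0 /= -big_filter.
set S := [seq _ <- _ | _].
have permS : perm_eq S [seq - y | y <- S].
  apply: uniq_perm; rewrite ?(map_inj_uniq oppr_inj) ?filter_uniq ?win_uniq // => y.
  by rewrite -[in RHS](opprK y) (mem_map oppr_inj) !mem_filter !mem_win abszN.
have : \sum_(y <- S) (y%:~R : R) ^+ j = - \sum_(y <- S) y%:~R ^+ j.
  rewrite {1}(perm_big _ permS) big_map -sumrN; apply: eq_bigr => y _.
  by rewrite rmorphN exprNn -signr_odd oddj expr1 mulN1r.
by move/eqP; rewrite -addr_eq0 -mulr2n mulrn_eq0 => /eqP.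
Qed.

Definition momp (e : bool) (j B : nat) : {poly R} :=
  \sum_(y <- win e B) y%:~R ^+ j *: 'X^(`|y| ^ 2).

Lemma coef_momp e j B i : (i <= B.*2 ^ 2)%N -> (momp e j B)`_i = psc (mom e j) i.
Proof.
move=> lei; rewrite (psc_mom e j B) // coef_sum [RHS]big_mkcond; apply: eq_bigr => y _.
by rewrite coefZ coefXn eq_sym; case: ifP; rewrite ?mulr1 ?mulr0.
Qed.

(** Distributing the product over the truncations [momp] yields one term for each function [k], the
    same index set by which the shells are enumerated. *)
Lemma psc_prod_mom n e (m : 'I_n -> nat) B N : (N <= B.*2 ^ 2)%N ->
  psc (\prod_i mom e (m i)) N =
  \sum_(k : {ffun 'I_n -> 'I_(win_size e B)} | (\sum_i `|win_elt e B (k i)| ^ 2 == N)%N)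
     \prod_i (win_elt e B (k i))%:~R ^+ m i.
Proof.
move=> leN.
rewrite -(psc_prod_trunc _ (fun i => mom e (m i)) (fun i => momp e (m i) B) N) //; last first.
  by move=> k i leiN; apply: coef_momp; apply: leq_trans leN.
under eq_bigr do rewrite /momp big_win.
rewrite bigA_distr_bigA /= coef_sum [RHS]big_mkcond; apply: eq_bigr => k _.
rewrite scaler_prod prodrXr coefZ coefXn eq_sym.
by case: ifP => _; rewrite ?mulr1 ?mulr0.
Qed.

Definition circle (e e' : bool) (N : nat) : seq (int * int) :=
  [seq p <- [seq (y, z) | y <- win e N, z <- win e' N] | (`|p.1| ^ 2 + `|p.2| ^ 2 == N)%N].

Lemma circle_uniq e e' N : uniq (circle e e' N).
Proof.
by rewrite filter_uniq // allpairs_uniq ?win_uniq // => -[? ?] [? ?].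
Qed.

Lemma mem_circle e e' N y z : ((y, z) \in circle e e' N) =
  [&& odd `|y| == e, odd `|z| == e' & (`|y| ^ 2 + `|z| ^ 2 == N)%N].
Proof.
rewrite mem_filter; apply/andP/and3P => /= [[eN /allpairsP[[? ?] /= [wy wz [yE zE]]]]|].
  by rewrite yE zE in eN *; move: wy wz; rewrite !mem_win => /andP[_ ?] /andP[_ ?]; split.
case=> oy oz eN; split=> //; apply/allpairsP; exists (y, z).
by rewrite /= !mem_win oy oz -(eqP eN) !andbT; split=> //; nia.
Qed.

Lemma sqr_abszD y z N :
  (`|y| ^ 2 + `|z| ^ 2 == N)%N = (y ^+ 2 + z ^+ 2 == N%:Z).
Proof.
have sq (w : int) : (`|w| ^ 2)%N%:Z = w ^+ 2.
  by rewrite -natz natrX natz abszE real_normK ?num_real.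
by rewrite -!sq -PoszD.
Qed.

Lemma psc_mom2 e e' N : psc (mom e 0 * mom e' 0) N = (size (circle e e' N))%:R.
Proof.
have leN i : (i <= N)%N -> (i <= N.*2 ^ 2)%N by nia.
have mp b i : (i <= N)%N -> (momp b 0 N)`_i = psc (mom b 0) i.
  by move=> /leN/coef_momp.
rewrite -(psc_mul_trunc N _ _ _ _ (mp e) (mp e')) // /momp mulr_suml coef_sum.
rewrite -sum1_size natr_sum /circle big_filter [RHS]big_mkcond [RHS]big_allpairs_dep /=.
apply: eq_bigr => y _; rewrite mulr_sumr coef_sum; apply: eq_bigr => z _.
by rewrite !expr0 !scale1r -exprD coefXn eq_sym; case: eqP.
Qed.

(* The map [(u, v) |-> (u + v, u - v)] is a similarity of ratio [sqrt 2] from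
   the pairs with [u + v] of parity [e] onto the pairs of two numbers of
   parity [e]. *)
Lemma mom0_sqr e :
  mom e 0 ^+ 2 = dil (mom false 0 * mom e 0 + mom true 0 * mom (~~ e) 0).
Proof.
apply/psP => N; rewrite expr2 psc_mom2 psc_dil; case: ifPn => oddN.
  (* Two numbers of equal parity have an even sum of squares, so the circle is empty. *)
  case: (circle e e N) (mem_circle e e N) => [//|[y z] s] memc.
  have := memc y z; rewrite mem_head => /esym/and3P[/eqP oy /eqP oz /eqP sN].
  by move: oddN; rewrite -sN oddD !oddX /= oy oz addbb.
set M := N./2; have {oddN}eN : N = M.*2 by rewrite even_halfK.
rewrite pscD !psc_mom2 -natrD -size_cat; congr _%:R.
pose f (p : int * int) := (p.1 + p.2, p.1 - p.2).
have f_inj : injective f by case=> [u v] [u' v'] [] /= e1 e2; congr (_, _); lia.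
rewrite -[RHS](size_map f); apply: perm_size; apply: uniq_perm.
- exact: circle_uniq.
(* The two circles are disjoint: the first coordinate is even on one and odd on the other. *)
- rewrite map_inj_uniq // cat_uniq !circle_uniq andbT /=; apply/hasPn => -[u v].
  rewrite !mem_circle => /and3P[/eqP -> _ _] //.
case=> y z; rewrite mem_circle sqr_abszD.
apply/and3P/mapP => [[/eqP oy /eqP oz /eqP sN]|].
  (* The preimage is [((y + z) / 2, (y - z) / 2)], written as [(u, u - z)] to avoid a second
     division. *)
  have [u yE] : exists u, y = u * 2 - z by exists ((y + z) %/ 2)%Z; clear -oy oz; lia.
  exists (u, u - z); last by rewrite /f /= yE; congr (_, _); ring.
  have sM : u ^+ 2 + (u - z) ^+ 2 = M%:Z.
    have : 2 * (u ^+ 2 + (u - z) ^+ 2) = 2 * M%:Z.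
      by rewrite -PoszM mul2n -eN -sN yE; ring.
    by move: (u ^+ 2 + _) => w; clear; lia.
  rewrite mem_cat !mem_circle !sqr_abszD sM eqxx !andbT.
  have {}oy : odd `|u - z| = odd `|u| (+) e by rewrite -oz; clear; lia.
  by rewrite oy; case: (odd `|u|); case: (e).
case=> -[u v]; rewrite mem_cat !mem_circle !sqr_abszD /f /= => uv [-> ->].
have [ou sM] : odd `|u| (+) odd `|v| = e /\ u ^+ 2 + v ^+ 2 = M%:Z.
  by case/orP: uv => /and3P[/eqP -> /eqP -> /eqP ->]; split=> //; case: (e).
split.
- by rewrite -ou; apply/eqP; clear; lia.
- by rewrite -ou; apply/eqP; clear; lia.
by rewrite eN -mul2n PoszM -sM; apply/eqP; ring.
Qed.

End Moments.

(** * Differential equations of the theta constants *)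

Section Theta.
Context {R : realFieldType}.

Local Notation A := (@mom R false 0).
Local Notation B := (@mom R true 0).
Local Notation A' := (@mom R false 2).
Local Notation B' := (@mom R true 2).
Local Notation A2 := (@mom R false 4).
Local Notation B2 := (@mom R true 4).
Local Notation A3 := (@mom R false 6).
Local Notation B3 := (@mom R true 6).

Lemma ps_natI k (s t : ps R) : k.+1%:R * s = k.+1%:R * t -> s = t.
Proof.
move=> est; apply/psP => N; have : psc (k.+1%:R * s) N = psc (k.+1%:R * t) N by rewrite est.
by rewrite !pscnM => /mulfI; apply; rewrite pnatr_eq0.
Qed.

Lemma supp_theta_even : supp 4 0 A.
Proof.
move=> N; apply: contraNeq => neqN; apply/eqP; rewrite /= big1_seq // => y.
rewrite mem_win => /andP[/eqP yN /andP[_ /eqP oy]]; case/negP: neqN.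
by rewrite -yN -(odd_double_half `|y|) oy add0n -muln2 expnMn modnMl.
Qed.

Lemma supp_theta_odd : supp 8 1 B.
Proof.
move=> N; apply: contraNeq => neqN; apply/eqP; rewrite /= big1_seq // => y.
rewrite mem_win => /andP[/eqP yN /andP[_ /eqP oy]]; case/negP: neqN.
rewrite -yN -(odd_double_half `|y|) oy; move: (`|y|./2)%N => k.
(* An odd square exceeds 8 times a triangular number by 1. *)
have -> : ((true + k.*2) ^ 2 = (k * k.+1)./2 * 8 + 1)%N.
  have := odd_double_half (k * k.+1); rewrite oddM /= andbN add0n.
  by move: (k * k.+1)./2 => h; nia.
by rewrite modnMDl.
Qed.

Lemma psc_theta_even0 : psc A 0 = 1.
Proof. by rewrite /= /win /= !big_cons big_nil /= addr0. Qed.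

Lemma psc_theta_even4 : psc A 4 = 2.
Proof. by rewrite (psc_mom _ _ 1) // /win /= !big_cons big_nil /= addr0. Qed.

Lemma psc_theta_odd0 : psc B 0 = 0.
Proof. exact: supp_psc0 supp_theta_odd _. Qed.

Lemma psc_theta_odd1 : psc B 1 = 2.
Proof. by rewrite (psc_mom _ _ 1) // /win /= !big_cons big_nil /= addr0. Qed.

Lemma theta_even_mulI s t : A * s = A * t -> s = t.
Proof.
move=> /eqP; rewrite -subr_eq0 -mulrBr => /eqP As0; apply/eqP.
rewrite -subr_eq0; apply/eqP; apply: (ps_mulI A _ 0) As0 => //.
by rewrite psc_theta_even0 oner_eq0.
Qed.

Lemma theta_odd_mulI s t : B * s = B * t -> s = t.
Proof.
move=> /eqP; rewrite -subr_eq0 -mulrBr => /eqP As0; apply/eqP.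
rewrite -subr_eq0; apply/eqP; apply: (ps_mulI B _ 1) As0 => [[|//] _|].
  exact: psc_theta_odd0.
by rewrite psc_theta_odd1 pnatr_eq0.
Qed.

Lemma theta_even_sqr : A ^+ 2 = dil (A ^+ 2 + B ^+ 2).
Proof. by rewrite [LHS]mom0_sqr !expr2. Qed.

Lemma theta_odd_sqr : B ^+ 2 = 2 * dil (A * B).
Proof. by rewrite mom0_sqr [B * _]mulrC -mulr2n raddfMn mulr_natl. Qed.

(** Half the derivative of [theta_even_sqr]; [dil] contributes a factor 2 by [psD_dil]. *)
Lemma theta_even_mulD : A * A' = 2 * dil (A * A' + B * B').
Proof.
apply: (ps_natI 1); transitivity (psD (A ^+ 2)); first by rewrite psDX psD_mom expr1 mulrA.
rewrite theta_even_sqr psD_dil raddfD /= !psDX !psD_mom !expr1.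
by rewrite !rmorphD /= !rmorphM /= !rmorph_nat; ring.
Qed.

Lemma theta_odd_mulD : B * B' = 2 * dil (A' * B + A * B').
Proof.
apply: (ps_natI 1); transitivity (psD (B ^+ 2)); first by rewrite psDX psD_mom expr1 mulrA.
by rewrite theta_odd_sqr psDn psD_dil psDM !psD_mom.
Qed.

(** It says that [B / A] has logarithmic derivative [A ^ 4 - B ^ 4]. Multiplied by [A * B], both
    sides involve only [A ^ 2], [B ^ 2], [A * A'] and [B * B'], which have duplication formulas. So
    their difference [y] satisfies [A * B * y = dil (2 * (A ^ 2 - B ^ 2) * y)], and it vanishes once
    its coefficients at 0 and 1 do. *)
Lemma theta_wronskian : A * B' - B * A' = A * B * (A ^+ 4 - B ^+ 4).
Proof.
apply/eqP; rewrite -subr_eq0; apply/eqP.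
apply: (dil_fixpoint_eq0 (A * B) (2 * (A ^+ 2 - B ^+ 2)) _ 1).
- by case=> // _; rewrite pscM big_ord1 psc_theta_odd0 mulr0.
- by rewrite [A * B]mulrC pscM1 ?psc_theta_odd0 // psc_theta_odd1 psc_theta_even0 mulr1 pnatr_eq0.
- have B'0 : psc B' 0 = 0 by rewrite -psD_mom psc_D mulr0n.
  have A'0 : psc A' 0 = 0 by rewrite -psD_mom psc_D mulr0n.
  have AB0 : psc (B * A) 0 = 0 by rewrite pscM0 psc_theta_odd0 mul0r.
  have V0 : psc (A ^+ 4 - B ^+ 4) 0 = 1.
    by rewrite pscD pscN !pscX0 psc_theta_odd0 psc_theta_even0 expr1n expr0n subr0.
  case=> [|[|//]] _; rewrite !(pscD, pscN) [A * B]mulrC [A * B']mulrC.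
    by rewrite !pscM0 psc_theta_odd0 A'0 B'0 !mul0r !subr0.
  rewrite !pscM1 ?psc_theta_odd0 // A'0 V0 psc_theta_even0 psc_theta_odd1.
  by rewrite -psD_mom psc_D psc_theta_odd1 mulr1n mulr0 !mulr1 subr0 subrr.
transitivity (A ^+ 2 * (B * B') - B ^+ 2 * (A * A')
              - A ^+ 2 * B ^+ 2 * ((A ^+ 2) ^+ 2 - (B ^+ 2) ^+ 2)); first by ring.
rewrite [in LHS]theta_odd_mulD [in LHS]theta_even_mulD.
rewrite [in LHS]theta_odd_sqr [in LHS]theta_even_sqr.
rewrite !(rmorphD, rmorphN, rmorphM, rmorph_nat, rmorphXn) /=.
ring.
Qed.

(** Without division, [B'] can be eliminated only after multiplication by [A], and [B2] only after
    multiplication by [A ^ 2]. The rule for [B2] comes from the derivative of the Wronskian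
    identity. *)
Let mulA_B' : A * B' = B * A' + A * B * (A ^+ 4 - B ^+ 4).
Proof. by rewrite -theta_wronskian addrC subrK. Qed.

Let mulA_B2 : A * (A * B2) = A * B * A2 + A * (A' * B) * (A ^+ 4 - B ^+ 4)
  + A * (A * B') * (A ^+ 4 - B ^+ 4)
  + A * B * (4 * A ^+ 4 * A' - 4 * B ^+ 3 * (A * B')).
Proof.
have := congr1 psD theta_wronskian.
rewrite !(psDD, psDN, psDM, psDX, psD_mom) => eW.
have -> : A * B2 = (A' * B' + A * B2 - (B' * A' + B * A2)) + B * A2 by ring.
by rewrite eW; ring.
Qed.

(** A second fixed-point argument: the duplication formulas and their derivatives give
    [A ^ 2 * y = dil Y] for the difference [y] of the two sides, and eliminating [B'] and [B2] gives
    [A ^ 2 * Y = 4 * (A ^ 2 + B ^ 2) ^ 2 * y]. *)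
Lemma theta_even_bracket4 :
  A * A2 - 3 * A' ^+ 2 = 2 * A ^+ 2 * B ^+ 4 * (A ^+ 4 - B ^+ 4).
Proof.
apply/eqP; rewrite -subr_eq0; apply/eqP; set y := _ - _.
apply: (dil_fixpoint_eq0 (dil (A ^+ 2) * A ^+ 2) (4 * (A ^+ 2 + B ^+ 2) ^+ 2) _ 0) => //.
- by rewrite pscM0 psc_dil !pscX0 psc_theta_even0 !expr1n mulr1 oner_eq0.
- case=> // _; rewrite /y !(pscD, pscN, pscX0, pscM0) psc_theta_odd0 -!psD_mom !psc_D !mulr0n.
  by rewrite !expr0n /= !(mulr0, mul0r, subr0).
pose dY := A' ^+ 2 + A * A2 + B' ^+ 2 + B * B2.
have dE : A' ^+ 2 + A * A2 = 4 * dil dY.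
  have := congr1 psD theta_even_mulD; rewrite psDn psD_dil psDM !psD_mom -expr2 => ->.
  by rewrite raddfD /= !psDM !psD_mom mulrA -natrM; congr (_ * dil _); rewrite /dY; ring.
pose Y := 4 * ((A ^+ 2 + B ^+ 2) * dY - 4 * (A * A' + B * B') ^+ 2)
  - 8 * (A ^+ 2 + B ^+ 2) ^+ 2 * (A * B) ^+ 2 * (A ^+ 2 - B ^+ 2) ^+ 2.
have yE : A ^+ 2 * y = dil Y.
  transitivity (A ^+ 2 * (A' ^+ 2 + A * A2) - 4 * (A * A') ^+ 2
    - 2 * (A ^+ 2) ^+ 2 * (B ^+ 2) ^+ 2 * ((A ^+ 2) ^+ 2 - (B ^+ 2) ^+ 2)).
    by rewrite /y; ring.
  rewrite dE [in LHS]theta_even_mulD [in LHS]theta_odd_sqr [in LHS]theta_even_sqr /Y /dY.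
  rewrite !(rmorphB, rmorphD, rmorphN, rmorphM, rmorph_nat, rmorphXn) /=; ring.
rewrite -mulrA yE -rmorphM; congr dil.
(* The factor [A ^ 2] is spread so that [B'] and [B2] occur only as [A * B'] and [A * (A * B2)], as
   the elimination rules require. *)
transitivity (4 * ((A ^+ 2 + B ^+ 2) * (A ^+ 2 * A' ^+ 2 + A ^+ 3 * A2 + (A * B') ^+ 2
      + B * (A * (A * B2))) - 4 * (A ^+ 2 * A' + B * (A * B')) ^+ 2)
  - 8 * A ^+ 2 * (A ^+ 2 + B ^+ 2) ^+ 2 * (A * B) ^+ 2 * (A ^+ 2 - B ^+ 2) ^+ 2).
  by rewrite /Y /dY; ring.
by rewrite mulA_B2 mulA_B' /y; ring.
Qed.

(** Multiplied by [A ^ 2], it follows from the even case by the elimination rules. *)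
Lemma theta_odd_bracket4 :
  B * B2 - 3 * B' ^+ 2 = - 2 * B ^+ 2 * A ^+ 4 * (A ^+ 4 - B ^+ 4).
Proof.
do 2!apply: theta_even_mulI.
transitivity (B * (A * (A * B2)) - 3 * (A * B') ^+ 2); first by ring.
rewrite mulA_B2 mulA_B'.
have -> : A * B * A2 = B * (A * A2 - 3 * A' ^+ 2) + 3 * B * A' ^+ 2 by ring.
by rewrite theta_even_bracket4; ring.
Qed.

(** The left-hand side is [A] times the derivative of the left-hand side of [theta_even_bracket4],
    minus [10 * A'] times the latter. *)
Lemma theta_even_bracket6 :
  A ^+ 2 * A3 - 15 * A * A' * A2 + 30 * A' ^+ 3 =
  8 * A ^+ 3 * B ^+ 4 * (A ^+ 4 - B ^+ 4) * (A ^+ 4 - 2 * B ^+ 4).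
Proof.
have := congr1 psD theta_even_bracket4.
rewrite !(psDD, psDN, psDn, psDM, psDX, psD_mom) => eW.
transitivity (A * (A' * A2 + A * A3 - 3 * (2 * A' ^+ 1 * A2))
  - 10 * A' * (A * A2 - 3 * A' ^+ 2)); first by ring.
rewrite eW theta_even_bracket4.
transitivity (4 * A ^+ 2 * B ^+ 4 * (A ^+ 4 - B ^+ 4) * A'
  + 8 * A ^+ 2 * B ^+ 3 * (A ^+ 4 - B ^+ 4) * (A * B')
  + 8 * A ^+ 2 * B ^+ 4 * (A ^+ 4 * A' - B ^+ 3 * (A * B'))
  - 20 * A ^+ 2 * B ^+ 4 * (A ^+ 4 - B ^+ 4) * A'); first by ring.
by rewrite mulA_B'; ring.
Qed.

Lemma theta_odd_bracket6 :
  B ^+ 2 * B3 - 15 * B * B' * B2 + 30 * B' ^+ 3 =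
  8 * B ^+ 3 * A ^+ 4 * (A ^+ 4 - B ^+ 4) * (2 * A ^+ 4 - B ^+ 4).
Proof.
have := congr1 psD theta_odd_bracket4.
rewrite !mulNr !(psDD, psDN, psDn, psDM, psDX, psD_mom) => eW.
transitivity (B * (B' * B2 + B * B3 - 3 * (2 * B' ^+ 1 * B2))
  - 10 * B' * (B * B2 - 3 * B' ^+ 2)); first by ring.
rewrite eW theta_odd_bracket4.
transitivity (- 4 * B ^+ 2 * A ^+ 3 * (A ^+ 4 - B ^+ 4) * (A * B')
  - 8 * B ^+ 3 * A ^+ 3 * (A ^+ 4 - B ^+ 4) * A'
  - 8 * B ^+ 3 * A ^+ 3 * (A ^+ 4 * A' - B ^+ 3 * (A * B'))
  + 20 * B ^+ 2 * A ^+ 3 * (A ^+ 4 - B ^+ 4) * (A * B')); first by ring.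
by rewrite mulA_B'; ring.
Qed.

End Theta.

(** * Vanishing coefficients *)

Section Dissection.
Context {R : realFieldType}.

Local Notation A := (@mom R false 0).
Local Notation B := (@mom R true 0).

(** Together with [theta_odd_X4] and [theta_X4B] this turns a polynomial in [A ^ 4] and [B ^ 4] into
    [dil] of a polynomial in [A ^ 2] and [B ^ 2], whose monomials can be sorted by their degree in
    [B] modulo 4. *)
Lemma theta_even_X4 : A ^+ 4 = dil ((A ^+ 2 + B ^+ 2) ^+ 2).
Proof. by rewrite (exprM _ 2 2) [in LHS]theta_even_sqr rmorphXn. Qed.

Lemma theta_odd_X4 : B ^+ 4 = dil (4 * (A ^+ 2 * B ^+ 2)).
Proof.
rewrite (exprM _ 2 2) [in LHS]theta_odd_sqr !(rmorphM, rmorphXn, rmorph_nat) /=.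
by ring.
Qed.

Lemma theta_X4B : A ^+ 4 - B ^+ 4 = dil ((A ^+ 2 - B ^+ 2) ^+ 2).
Proof. by rewrite theta_odd_X4 theta_even_X4 -rmorphB; congr dil; ring. Qed.

(** This splits the even integers [2 * k] by the parity of [k]. By the duplication formulas both
    sides have the same square, and their sum can be cancelled because its constant term is 2. *)
Lemma theta_even_dil2 : A = dil (dil (A + B)).
Proof.
set s := dil _; have sE : A ^+ 2 = s ^+ 2.
  rewrite theta_even_sqr /s -!rmorphXn; congr dil.
  rewrite [in LHS]theta_odd_sqr [in LHS]theta_even_sqr -[2](rmorph_nat dil) -rmorphM -rmorphD.
  by congr dil; ring.
apply/eqP; rewrite -subr_eq0; apply/eqP; apply: (ps_mulI (A + s) _ 0) => //.
- rewrite pscD !(psc_dil_double _ 0) pscD psc_theta_even0 psc_theta_odd0 addr0.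
  by rewrite -[1]/(1%:R) -natrD pnatr_eq0.
- by rewrite mulrC -subr_sqr sE subrr.
Qed.

Lemma supp_theta_mon1 r i j : j = r %[mod 4] -> supp 4 r (A ^+ i * B ^+ j).
Proof.
move=> jr; have B4 : supp 4 1 B.
  by move=> N /supp_theta_odd eN; rewrite -(modn_dvdm N (isT : 4 %| 8)%N) eN.
apply: (supp_eqmod _ (0 * i + 1 * j)%N); first by rewrite mul0n mul1n.
by apply: suppM; apply: suppX => //; apply: supp_theta_even.
Qed.

Lemma supp_theta_mon r k i j : j = r %[mod 4] -> supp 4 r (k%:R * A ^+ i * B ^+ j).
Proof.
move=> /supp_theta_mon1 mon1; rewrite -mulrA.
exact: suppM (suppn _ k) (mon1 i).
Qed.

Ltac supp_theta :=
  repeat first [exact: supp_theta_mon | exact: supp_theta_mon1 | apply: suppD | apply: suppN].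

Lemma supp_dil d r s : supp d r s -> supp d.*2 r.*2 (dil s : ps R).
Proof.
move=> Hs N; rewrite psc_dil; case: ifPn => [|/even_halfK eN /Hs]; first by rewrite eqxx.
by rewrite -{2}eN -!muln2 -!muln_modl => ->.
Qed.

Lemma psc_dil_nat k (s : ps R) N : psc (k%:R * dil s) N.*2 = k%:R * psc s N.
Proof. by rewrite pscnM psc_dil_double. Qed.

(** All monomials of [s] have degree 2 modulo 4 in [B], and [dil] doubles the exponents. The shells
    of norm [2 * a] sit at the exponents [8 * a], outside this class. *)
Lemma supp_harmonic4_Z4 : supp 8 4 (A ^+ 4 * B ^+ 4 * (A ^+ 4 - B ^+ 4)).
Proof.
rewrite theta_X4B theta_even_X4 theta_odd_X4 -!rmorphM.
apply: (supp_dil 4 2); set s := _ * _.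
have -> : s = 4 * A ^+ 10 * B ^+ 2 - 8 * A ^+ 6 * B ^+ 6 + 4 * A ^+ 2 * B ^+ 10.
  by rewrite /s; ring.
by supp_theta.
Qed.

(** After one dilation the series is again a polynomial in fourth powers, since [(A ^ 2 + B ^ 2) *
    (A ^ 2 - B ^ 2) = A ^ 4 - B ^ 4]; after a second one all degrees in [B] are 0 modulo 4. The
    norms [4 * a + 2] sit at the exponents [16 * a + 8]. *)
Lemma supp_harmonic4_Sh16 : supp 16 0 (B ^+ 16 * A ^+ 4 * (A ^+ 4 - B ^+ 4)).
Proof.
rewrite (exprM _ 4 4) theta_X4B theta_even_X4 theta_odd_X4 -!(rmorphXn, rmorphM).
apply: (supp_dil 8 0).
have -> : (4 * (A ^+ 2 * B ^+ 2)) ^+ 4 * (A ^+ 2 + B ^+ 2) ^+ 2 * (A ^+ 2 - B ^+ 2) ^+ 2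
  = 256 * ((A ^+ 4) ^+ 2 * (B ^+ 4) ^+ 2 * (A ^+ 4 - B ^+ 4) ^+ 2) by ring.
apply: (suppM _ 0 0); first exact: suppn.
rewrite theta_X4B theta_even_X4 theta_odd_X4 -!(rmorphXn, rmorphM).
apply: (supp_dil 4 0); set s := _ * _.
have -> : s = 16 * A ^+ 20 * B ^+ 4 - 64 * A ^+ 16 * B ^+ 8 + 96 * A ^+ 12 * B ^+ 12
  - 64 * A ^+ 8 * B ^+ 16 + 16 * A ^+ 4 * B ^+ 20 by rewrite /s; ring.
by supp_theta.
Qed.

Lemma theta_odd_X4_dil2 : B ^+ 4 = 8 * dil (dil (A * B * (A ^+ 2 + B ^+ 2))).
Proof.
rewrite theta_odd_X4 [in LHS]theta_odd_sqr [in LHS]theta_even_sqr.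
by rewrite !(rmorphM, rmorphD, rmorphXn, rmorph_nat) /=; ring.
Qed.

Lemma theta_X4B_dil2 : A ^+ 4 - B ^+ 4 = dil (dil ((A - B) ^+ 4)).
Proof.
rewrite theta_X4B [in LHS]theta_odd_sqr [in LHS]theta_even_sqr.
by rewrite !(rmorphM, rmorphD, rmorphN, rmorphXn, rmorph_nat) /=; ring.
Qed.

(* The parts of [(A + B) ^+ 7 * A * B * (A ^+ 2 + B ^+ 2) * (A - B) ^+ 4] whose
   exponents are congruent to 0 and 3 modulo 4 are multiples of known series. *)
Lemma harmonic4_Z7_dil2 (h := A ^+ 7 * B ^+ 4 * (A ^+ 4 - B ^+ 4)) :
  h = 8 * dil (dil (8 * (B ^+ 3 * (A ^+ 4 * B ^+ 4 * (A ^+ 4 - B ^+ 4))) - 8 * h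
    + (A ^+ 14 * B ^+ 1 - 7 * A ^+ 10 * B ^+ 5 + 3 * A ^+ 6 * B ^+ 9
       + 3 * A ^+ 2 * B ^+ 13)
    + (3 * A ^+ 13 * B ^+ 2 + 3 * A ^+ 9 * B ^+ 6 - 7 * A ^+ 5 * B ^+ 10
       + A ^+ 1 * B ^+ 14))).
Proof.
transitivity (8 * dil (dil ((A + B) ^+ 7 * (A * B * (A ^+ 2 + B ^+ 2)) * (A - B) ^+ 4))).
  rewrite /h theta_X4B_dil2 theta_odd_X4_dil2 {1}theta_even_dil2.
  by rewrite !(rmorphXn, rmorphM) /=; ring.
by congr (_ * dil (dil _)); rewrite /h; ring.
Qed.

(** The coefficient of [h] at [4 * N] combines four coefficients at [N]. For [N = 8 * b + 3] only
    the series with [B ^ 3] lives on the right class modulo 4, but it lives on 7 modulo 8. For [N]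
    divisible by 4 only [h] itself survives, which gives the induction on [a]. *)
Lemma psc_harmonic4_Z7 a b :
  psc (A ^+ 7 * B ^+ 4 * (A ^+ 4 - B ^+ 4)) (4 ^ a * (32 * b + 12)) = 0.
Proof.
have supp3 : supp 8 7 (B ^+ 3 * (A ^+ 4 * B ^+ 4 * (A ^+ 4 - B ^+ 4))).
  exact: (suppM _ (1 * 3) 4 _ _ (suppX _ _ _ 3 supp_theta_odd) supp_harmonic4_Z4).
have supp3' : supp 4 3 (B ^+ 3 * (A ^+ 4 * B ^+ 4 * (A ^+ 4 - B ^+ 4))).
  by move=> N /supp3 eN; rewrite -(modn_dvdm N (isT : 4 %| 8)%N) eN.
set h := A ^+ 7 * _ * _.
have supp0 : supp 4 0 h.
  have -> : h = A ^+ 11 * B ^+ 4 - A ^+ 7 * B ^+ 8 by rewrite /h; ring.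
  by supp_theta.
set h1 := A ^+ 14 * B ^+ 1 - 7 * A ^+ 10 * B ^+ 5 + 3 * A ^+ 6 * B ^+ 9
  + 3 * A ^+ 2 * B ^+ 13.
set h2 := 3 * A ^+ 13 * B ^+ 2 + 3 * A ^+ 9 * B ^+ 6 - 7 * A ^+ 5 * B ^+ 10
  + A ^+ 1 * B ^+ 14.
have supp1 : supp 4 1 h1 by rewrite /h1; supp_theta.
have supp2 : supp 4 2 h2 by rewrite /h2; supp_theta.
have step N : psc h (4 * N) = 8 * (8 * psc (B ^+ 3 * (A ^+ 4 * B ^+ 4 * (A ^+ 4 - B ^+ 4))) N
    - 8 * psc h N + psc h1 N + psc h2 N).
  have -> : (4 * N)%N = N.*2.*2 by lia.
  rewrite [in LHS]/h harmonic4_Z7_dil2 psc_dil_nat psc_dil_double.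
  by rewrite 3!pscD pscN 2!pscnM.
move: (B ^+ 3 * _) supp3 supp3' step => s3 supp3 supp3'; clearbody h h1 h2 => step.
elim: a => [|a IH].
  rewrite (_ : (4 ^ 0 * _)%N = (4 * (8 * b + 3))%N); last by lia.
  rewrite step (supp_psc0 _ _ _ _ supp3); last by lia.
  rewrite (supp_psc0 _ _ _ _ supp0); last by lia.
  rewrite (supp_psc0 _ _ _ _ supp1); last by lia.
  rewrite (supp_psc0 _ _ _ _ supp2); last by lia.
  by rewrite !mulr0 subr0 !addr0 mulr0.
have dvd4 : (4 ^ a * (32 * b + 12) = 4 * (4 ^ a * (8 * b + 3)))%N by lia.
rewrite expnS -mulnA step IH (supp_psc0 _ _ _ _ supp3'); last by rewrite dvd4; lia.
rewrite (supp_psc0 _ _ _ _ supp1); last by rewrite dvd4; lia.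
rewrite (supp_psc0 _ _ _ _ supp2); last by rewrite dvd4; lia.
by rewrite !mulr0 subr0 !addr0 mulr0.
Qed.

(** * Dissections for the degree 6 series *)

Lemma supp_theta_X4B k : supp 4 0 ((A ^+ 4 - B ^+ 4) ^+ k).
Proof.
apply: (suppX _ 0).
have -> : A ^+ 4 - B ^+ 4 = A ^+ 4 * B ^+ 0 - A ^+ 0 * B ^+ 4 by ring.
by supp_theta.
Qed.

(** One step of descent: at multiples of 4 the part [h] on exponents 2 modulo 4 is invisible. *)
Lemma psc_dil_mod4 (s t g h : ps R) k N :
    s = dil t -> t = k%:R * (g + h) -> supp 4 2 h -> (4 %| N)%N ->
  psc s N.*2 = k%:R * psc g N.
Proof.
move=> -> -> Hh dvdN; rewrite psc_dil_double pscnM pscD (supp_psc0 _ _ _ _ Hh) ?addr0 //.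
by rewrite (eqP dvdN).
Qed.

Lemma psc_expr_low (s : ps R) k n : (forall i, (i < k)%N -> psc s i = 0) ->
  (forall i, (i < k * n)%N -> psc (s ^+ n) i = 0) /\
  psc (s ^+ n) (k * n)%N = psc s k ^+ n.
Proof.
move=> s0; elim: n => [|n [IH0 IHn]]; first by rewrite muln0 psc1.
rewrite [s ^+ _]exprS mulnS addnC psc_mul_low // IHn [RHS]exprS; split=> // i lti.
rewrite pscM big1 // => j _; have [/s0->|gej] := ltnP j k; first by rewrite mul0r.
by rewrite IH0 ?mulr0 //; move: (ltn_ord j); lia.
Qed.

Lemma psc_theta_odd_expr n i : (i < n)%N -> psc (B ^+ n) i = 0.
Proof.
move=> lti; have [|B0 _] := psc_expr_low B 1 n; last by apply: B0; rewrite mul1n.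
by case=> // _; apply: psc_theta_odd0.
Qed.

Lemma psc_theta_odd_exprn n : psc (B ^+ n) n = 2 ^+ n.
Proof.
have [|_] := psc_expr_low B 1 n; last by rewrite mul1n psc_theta_odd1.
by case=> // _; apply: psc_theta_odd0.
Qed.

Lemma psc_theta_odd_mul n s i : (i < n)%N -> psc (B ^+ n * s) i = 0.
Proof.
move=> lti; rewrite pscM big1 // => j _; rewrite psc_theta_odd_expr ?mul0r //.
by move: (ltn_ord j); lia.
Qed.

(** In dimension 16 both degree 6 series reduce to this one after one dilation, and it reproduces
    itself after two, up to constant factors and parts on exponents 2 modulo 4. *)
Definition harmonic6_16 : ps R :=
  A ^+ 8 * B ^+ 8 * (A ^+ 4 - B ^+ 4) ^+ 2 * (A ^+ 4 + B ^+ 4).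

Let rest16 : ps R := (A ^+ 18 * B ^+ 2 - 20 * A ^+ 14 * B ^+ 6 - 90 * A ^+ 10 * B ^+ 10
  - 20 * A ^+ 6 * B ^+ 14 + A ^+ 2 * B ^+ 18) * (A ^+ 4 - B ^+ 4) ^+ 2.

Let supp_rest16 : supp 4 2 rest16.
Proof. by apply: (suppM _ 2 0); [supp_theta | apply: supp_theta_X4B]. Qed.

(** The factor [B ^ 8] settles exponent 4. The two dissections make the coefficient at [4 * M] a
    constant multiple of the one at [M] whenever 4 divides [M]. *)
Lemma psc_harmonic6_16 a : psc harmonic6_16 (4 ^ a.+1) = 0.
Proof.
elim: a => [|a IH].
  have -> : harmonic6_16 = B ^+ 8 * (A ^+ 8 * (A ^+ 4 - B ^+ 4) ^+ 2 * (A ^+ 4 + B ^+ 4)).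
    by rewrite /harmonic6_16; ring.
  exact: psc_theta_odd_mul.
set g := A ^+ 4 * B ^+ 4 * (A ^+ 4 - B ^+ 4) ^+ 4 * (A ^+ 4 + B ^+ 4).
have step1 N : (4 %| N)%N -> psc harmonic6_16 N.*2 = 16 * psc g N.
  apply: (psc_dil_mod4 _ _ _ (6 * A ^+ 6 * B ^+ 6 * (A ^+ 4 - B ^+ 4) ^+ 4)).
  - rewrite /harmonic6_16 (exprM _ 4 2) (exprM B 4 2) theta_X4B theta_even_X4 theta_odd_X4.
    by rewrite -!(rmorphXn, rmorphM, rmorphD).
  - by rewrite /g; ring.
  - by apply: (suppM _ 2 0); [supp_theta | apply: supp_theta_X4B].
have step2 N : (4 %| N)%N -> psc g N.*2 = 4 * psc (64 * harmonic6_16) N.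
  apply: (psc_dil_mod4 _ _ _ rest16); last exact: supp_rest16.
  - rewrite /g theta_X4B theta_even_X4 theta_odd_X4.
    by rewrite -!(rmorphXn, rmorphM, rmorphD).
  - by rewrite /rest16 /harmonic6_16; ring.
have -> : (4 ^ a.+2 = (4 ^ a.+1).*2.*2)%N by rewrite expnS; lia.
rewrite step1; last by rewrite expnS; lia.
by rewrite step2 ?pscnM ?IH ?mulr0 // expnS dvdn_mulr.
Qed.

Lemma psc_harmonic6_Z16 a :
  psc (A ^+ 16 * B ^+ 4 * (A ^+ 4 - B ^+ 4) * (A ^+ 4 - 2 * B ^+ 4)) (8 * 4 ^ a) = 0.
Proof.
have -> : (8 * 4 ^ a = (4 ^ a.+1).*2)%N by rewrite expnS; lia.
rewrite (psc_dil_mod4 _ ((A ^+ 2 + B ^+ 2) ^+ 8 * (4 * (A ^+ 2 * B ^+ 2))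
  * (A ^+ 2 - B ^+ 2) ^+ 2 * ((A ^+ 2 + B ^+ 2) ^+ 2 - 2 * (4 * (A ^+ 2 * B ^+ 2))))
  (- (64 * harmonic6_16)) rest16 4) //.
- by rewrite pscN pscnM psc_harmonic6_16 mulr0 oppr0 mulr0.
- rewrite (exprM _ 4 4) theta_X4B theta_even_X4 theta_odd_X4.
  by rewrite !(rmorphXn, rmorphM, rmorphD, rmorphN, rmorph_nat) /=; ring.
- by rewrite /rest16 /harmonic6_16; ring.
- by rewrite expnS dvdn_mulr.
Qed.

Lemma psc_harmonic6_Sh16 a :
  psc (B ^+ 16 * A ^+ 4 * (A ^+ 4 - B ^+ 4) * (2 * A ^+ 4 - B ^+ 4)) (8 * 4 ^ a) = 0.
Proof.
have -> : (8 * 4 ^ a = (4 ^ a.+1).*2)%N by rewrite expnS; lia.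
set s := _ * _; have -> : s = 512 * dil harmonic6_16.
  rewrite /s (exprM _ 4 4) theta_X4B theta_even_X4 theta_odd_X4 /harmonic6_16.
  by rewrite !(rmorphXn, rmorphM, rmorphD, rmorphN, rmorph_nat) /=; ring.
by rewrite psc_dil_nat psc_harmonic6_16 mulr0.
Qed.

(** The derivative of the power contains one factor [psD A], which starts at exponent 4 with
    coefficient 8. *)
Lemma psc_theta_even_expr4 n : psc (A ^+ n.+1) 4 = 2 * n.+1%:R.
Proof.
have A'0 i : (i < 4)%N -> psc (psD A) i = 0.
  case: i => [|i] lti; first by rewrite psc_D mulr0n.
  by rewrite psc_D (supp_psc0 _ _ _ _ supp_theta_even) ?mul0rn //; lia.
have : psc (psD (A ^+ n.+1)) 4 = n.+1%:R * (8 : R).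
  rewrite psDX -mulrA pscnM [_ * psD A]mulrC (psc_mul_low _ _ 4 0) // psc_D.
  by rewrite pscX0 psc_theta_even0 expr1n psc_theta_even4 mulr1 -mulrnA.
rewrite psc_D => e8; apply: (mulIf (_ : 4%:R != 0)); first by rewrite pnatr_eq0.
by rewrite mulr_natr e8; ring.
Qed.

(** The supports allow only the splittings [4 + 8] and [12 + 0], and [psc t 0 = 0] excludes the
    second. *)
Lemma psc_mul_sparse12 (s t : ps R) :
  supp 4 0 s -> supp 8 0 t -> psc t 0 = 0 -> psc (s * t) 12 = psc s 4 * psc t 8.
Proof.
move=> Hs Ht t0; rewrite pscM (bigD1 (Ordinal (isT : 4 < 13)%N)) // big1 => [|i nei].
  exact: addr0.
have [i4|] := boolP (i == 0 %[mod 4]); last by move=> ni; rewrite (supp_psc0 _ _ _ _ Hs ni) mul0r.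
have [i8|] := boolP (12 - i == 0 %[mod 8])%N; last first.
  by move=> ni; rewrite (supp_psc0 _ _ _ _ Ht ni) mulr0.
rewrite (_ : (12 - i = 0)%N) ?t0 ?mulr0 //.
by move: nei i4 i8 (ltn_ord i); rewrite -val_eqE /=; lia.
Qed.

(** Three dissections lead from exponent 96 to 48, 24 and 12. At 12 only the terms with [B ^ 8] and
    [B ^ 12] count, and they cancel numerically: [2 * 88 * 2 ^ 8 = 11 * 2 ^ 12]. *)
Lemma psc_harmonic6_Sh40 :
  psc (B ^+ 40 * A ^+ 4 * (A ^+ 4 - B ^+ 4) * (2 * A ^+ 4 - B ^+ 4)) 96 = 0.
Proof.
set g1 := (A ^+ 4) ^+ 5 * (B ^+ 4) ^+ 5 * (A ^+ 4 - B ^+ 4) ^+ 2 * (A ^+ 4 + B ^+ 4).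
set s := _ * _; have -> : s = 2 ^+ 21 * dil g1.
  rewrite /s (exprM _ 4 10) theta_X4B theta_even_X4 theta_odd_X4 /g1.
  by rewrite !(rmorphXn, rmorphM, rmorphD, rmorphN, rmorph_nat) /=; ring.
rewrite -natrX (psc_dil_nat _ _ 48).
set g2 := (A ^+ 4) ^+ 3 * (B ^+ 4) ^+ 3 * (A ^+ 4 - B ^+ 4) ^+ 4 * (3 * (A ^+ 4) ^+ 3
  + 29 * (A ^+ 4) ^+ 2 * B ^+ 4 + 29 * A ^+ 4 * (B ^+ 4) ^+ 2 + 3 * (B ^+ 4) ^+ 3).
(* [4 * g2] collects the monomials of degree 0 modulo 4 in [B]; the explicit polynomial after it
   collects those of degree 2. *)
rewrite (psc_dil_mod4 _ ((A ^+ 2 + B ^+ 2) ^+ 10 * (4 * (A ^+ 2 * B ^+ 2)) ^+ 5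
  * (A ^+ 2 - B ^+ 2) ^+ 4 * ((A ^+ 2 + B ^+ 2) ^+ 2 + 4 * (A ^+ 2 * B ^+ 2)))
  (4 * g2) ((A ^+ 26 * B ^+ 10 + 52 * A ^+ 22 * B ^+ 14 + 150 * A ^+ 18 * B ^+ 18
    + 52 * A ^+ 14 * B ^+ 22 + A ^+ 10 * B ^+ 26) * (A ^+ 4 - B ^+ 4) ^+ 4) (4 ^ 5) 24) //.
2: { rewrite /g1 theta_X4B theta_even_X4 theta_odd_X4.
  rewrite !(rmorphXn, rmorphM, rmorphD, rmorphN, rmorph_nat) /=; ring. }
2: by rewrite /g2 natrX; ring.
2: by apply: (suppM _ 2 0); [supp_theta | apply: supp_theta_X4B].
set g3 := A ^+ 8 * B ^+ 8 * (A ^+ 4 - B ^+ 4) ^+ 6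
  * (2 * A ^+ 12 + A ^+ 8 * B ^+ 4 + A ^+ 4 * B ^+ 8 + 2 * B ^+ 12).
rewrite pscnM (psc_dil_mod4 _ ((A ^+ 2 + B ^+ 2) ^+ 6 * (4 * (A ^+ 2 * B ^+ 2)) ^+ 3
  * (A ^+ 2 - B ^+ 2) ^+ 8 * (3 * (A ^+ 2 + B ^+ 2) ^+ 6
  + 29 * (A ^+ 2 + B ^+ 2) ^+ 4 * (4 * (A ^+ 2 * B ^+ 2))
  + 29 * (A ^+ 2 + B ^+ 2) ^+ 2 * (4 * (A ^+ 2 * B ^+ 2)) ^+ 2
  + 3 * (4 * (A ^+ 2 * B ^+ 2)) ^+ 3))
  (64 * g3) ((3 * A ^+ 22 * B ^+ 6 + 708 * A ^+ 18 * B ^+ 10 - 1806 * A ^+ 14 * B ^+ 14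
    + 708 * A ^+ 10 * B ^+ 18 + 3 * A ^+ 6 * B ^+ 22) * (A ^+ 4 - B ^+ 4) ^+ 6) 64 12) //.
2: { rewrite /g2 theta_X4B theta_even_X4 theta_odd_X4.
  rewrite !(rmorphXn, rmorphM, rmorphD, rmorphN, rmorph_nat) /=; ring. }
2: by rewrite /g3; ring.
2: by apply: (suppM _ 2 0); [supp_theta | apply: supp_theta_X4B].
rewrite pscnM; suff -> : psc g3 12 = 0 by rewrite !mulr0.
have -> : g3 = 2 * (A ^+ 44 * B ^+ 8) - 11 * (A ^+ 40 * B ^+ 12) + B ^+ 16 * (A ^+ 8
    * (25 * A ^+ 28 - 29 * A ^+ 24 * B ^+ 4 + 13 * A ^+ 20 * B ^+ 8 + 13 * A ^+ 16 * B ^+ 12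
    - 29 * A ^+ 12 * B ^+ 16 + 25 * A ^+ 8 * B ^+ 20 - 11 * A ^+ 4 * B ^+ 24 + 2 * B ^+ 28)).
  by rewrite /g3; ring.
rewrite !(pscD, pscN) psc_theta_odd_mul // !pscnM.
have -> : psc (A ^+ 40 * B ^+ 12) 12 = 2 ^+ 12.
  rewrite (psc_mul_low _ _ 0 12) //; last by move=> i; apply: psc_theta_odd_expr.
  by rewrite psc_theta_odd_exprn pscX0 psc_theta_even0 expr1n mul1r.
have -> : psc (A ^+ 44 * B ^+ 8) 12 = 88 * 2 ^+ 8.
  rewrite psc_mul_sparse12.
  - by rewrite psc_theta_even_expr4 psc_theta_odd_exprn -natrM.
  - exact: (suppX _ _ _ 44 supp_theta_even).
  - exact: (supp_eqmod _ (1 * 8) _ _ _ (suppX _ _ _ 8 supp_theta_odd)).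
  - exact: psc_theta_odd_expr.
by ring.
Qed.

End Dissection.

(** * Theta series with polynomial coefficients *)

(** The Laplacian for [k = 2]; the cases 4 and 6 carry the cumulant corrections. *)
Definition pderiv {R : nzRingType} {n : nat} (k : nat) (P : {mpoly R[n]}) : {mpoly R[n]} :=
  \sum_i P^`M(i, k).

Section HomogeneousDerivatives.
Context {R : nzRingType} {n : nat}.
Implicit Types P : {mpoly R[n]}.

Lemma dhomog_mdeg P d m : P \is d.-homog -> m \in msupp P -> mdeg m = d.
Proof. by move=> /dhomog_mf homP /homP. Qed.

Lemma msupp_mderivn P d i k m :
  P \is d.-homog -> m \in msupp P^`M(i, k) -> (k + mdeg m = d)%N.
Proof.
move=> homP; rewrite mcoeff_msupp mcoeff_mderivm => nz.
have : P@_(U_(i) *+ k + m) != 0 by apply: contraNneq nz => ->; rewrite mul0rn.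
rewrite -mcoeff_msupp => /(dhomog_mdeg P _ _ homP).
by rewrite mdegD mdegMn mdeg1 mul1n.
Qed.

Lemma dhomog_pderiv P d k : P \is (k + d).-homog -> pderiv k P \is d.-homog.
Proof.
move=> homP; rewrite rpred_sum // => i _; apply/dhomogP => m mP.
by apply: (@addnI k); apply: msupp_mderivn homP mP.
Qed.

Lemma pderiv_eq0 P d k : P \is d.-homog -> (d < k)%N -> pderiv k P = 0.
Proof.
move=> homP ltdk; apply: big1 => i _; apply/eqP; rewrite -msupp_eq0.
case E: (msupp _) => [//|m s].
by have := msupp_mderivn P d i k m homP; rewrite E mem_head => /(_ isT); lia.
Qed.

Lemma pderivC P k l : pderiv k (pderiv l P) = pderiv l (pderiv k P).
Proof.
rewrite /pderiv; under eq_bigr do rewrite raddf_sum.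
under [RHS]eq_bigr do rewrite raddf_sum.
by rewrite exchange_big; do 2!apply: eq_bigr => ? _; rewrite /= -!mderivmDm addmC.
Qed.

Lemma dhomog0_const P : P \is 0.-homog -> P = (P@_0)%:MP.
Proof.
move=> homP; apply/mpolyP => m; rewrite mcoeffC.
have [->|nem0] := eqVneq m 0%MM; first by rewrite mulr1.
rewrite mulr0; apply/eqP; apply: contraNT nem0.
by rewrite -mcoeff_msupp => /(dhomog_mdeg P _ _ homP)/eqP; rewrite mdeg_eq0.
Qed.

End HomogeneousDerivatives.

Section ThetaFunctional.
Context {R : realFieldType} (n : nat) (e : bool).
Implicit Types P Q : {mpoly R[n]}.
Local Notation f := (@mom R e).

(** The theta series weighted by [P], in doubled coordinates: on a monomial the sum over the product
    lattice factors into moments of the single coordinates. *)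
Definition theta_mpoly P : ps R :=
  \sum_(m <- msupp P) psC P@_m * \prod_(i < n) f (m i).
Local Notation Lam := theta_mpoly.

Lemma theta_mpolyE k P : (msize P <= k)%N ->
  Lam P = \sum_(m : 'X_{1..n < k}) psC P@_m * \prod_(i < n) f (m i).
Proof.
move=> lePk; rewrite /Lam (big_mksub 'X_{1..n < k}) ?msupp_uniq //=; last first.
  by move=> m /msize_mdeg_lt /leq_trans; apply.
by rewrite big_rmcond //= => m /memN_msupp_eq0 ->; rewrite rmorph0 mul0r.
Qed.

Lemma theta_mpoly_linear c P Q : Lam (c *: P + Q) = psC c * Lam P + Lam Q.
Proof.
pose k := maxn (msize (c *: P + Q)) (maxn (msize P) (msize Q)).
rewrite !(theta_mpolyE k) ?leq_max ?leqnn ?orbT // mulr_sumr -big_split.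
apply: eq_bigr => m _ /=; rewrite mcoeffD mcoeffZ rmorphD rmorphM /=; ring.
Qed.

Lemma theta_mpoly0 : Lam 0 = 0. Proof. by rewrite /Lam msupp0 big_nil. Qed.

Lemma theta_mpolyD P Q : Lam (P + Q) = Lam P + Lam Q.
Proof. by rewrite -[P]scale1r theta_mpoly_linear rmorph1 mul1r scale1r. Qed.

Lemma theta_mpolyZ c P : Lam (c *: P) = psC c * Lam P.
Proof. by rewrite -[c *: P]addr0 theta_mpoly_linear theta_mpoly0 addr0. Qed.

Lemma theta_mpoly_sum I (r : seq I) (F : I -> {mpoly R[n]}) :
  Lam (\sum_(i <- r) F i) = \sum_(i <- r) Lam (F i).
Proof. by apply: (big_morph _ theta_mpolyD theta_mpoly0). Qed.

Lemma theta_mpolyX m : Lam 'X_[m] = \prod_i f (m i).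
Proof. by rewrite /Lam msuppX big_seq1 mcoeffX eqxx rmorph1 mul1r. Qed.

Lemma theta_mpolyC c : Lam c%:MP = psC c * f 0 ^+ n.
Proof.
rewrite -[c%:MP]mulr1 -[1]mpolyX0 mul_mpolyC theta_mpolyZ theta_mpolyX.
by under eq_bigr do rewrite mnm0E; rewrite prodr_const card_ord.
Qed.

(** For [m i < k] the falling factorial is 0, so the truncated subtraction does no harm. *)
Lemma theta_mpoly_mderivnX m i k : Lam ('X_[m]^`M(i, k)) =
  ((m i) ^_ k)%:R * f (m i - k) * \prod_(j | j != i) f (m j).
Proof.
rewrite mderivnX theta_mpolyZ theta_mpolyX rmorph_nat -mulrA; congr (_ * _).
rewrite (bigD1 i) //= mnmBE mulmnE mnm1E eqxx mul1n; congr (_ * _).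
by apply: eq_bigr => j neji; rewrite mnmBE mulmnE mnm1E eq_sym (negbTE neji) subn0.
Qed.

(* Up to powers of [f 0], these are the fourth and sixth cumulants of the
   weights [x ^ (y ^ 2)] on the integers [y] of parity [e]. *)
Definition bracket4 : ps R := f 0 * f 4 - 3 * f 2 ^+ 2.
Definition bracket6 : ps R := f 0 ^+ 2 * f 6 - 15 * f 0 * f 2 * f 4 + 30 * f 2 ^+ 3.

(** Let [M] be the exponential generating function of the moments. Then [t M' / M] is [t] times the
    derivative of the cumulant generating function, that is
    [k2 t ^ 2 + k4 t ^ 4 / 3! + k6 t ^ 6 / 5!] up to degree 6. Comparing coefficients in [t M'] and
    clearing the denominator [f 0 ^ 3] gives the recurrence. *)
Lemma moment_recurrence k : (k <= 6)%N ->
  k%:R * (f 0 ^+ 3 * f k) = f 0 ^+ 2 * f 2 * ((k ^_ 2)%:R * f (k - 2))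
    + psC 6^-1 * f 0 * bracket4 * ((k ^_ 4)%:R * f (k - 4))
    + psC 120^-1 * bracket6 * ((k ^_ 6)%:R * f (k - 6)).
Proof.
have inv6 : psC (6^-1 : R) * 24%:R = 4.
  by rewrite -(rmorph_nat psC) -rmorphM -[4](rmorph_nat psC); congr psC; field.
have inv6' : psC (6^-1 : R) * 360%:R = 60.
  by rewrite -(rmorph_nat psC) -rmorphM -[60](rmorph_nat psC); congr psC; field.
have inv120 : psC (120^-1 : R) * 720%:R = 6.
  by rewrite -(rmorph_nat psC) -rmorphM -[6](rmorph_nat psC); congr psC; field.
case: k => [|[|[|[|[|[|[|//]]]]]]] _.
- by rewrite !mul0r !mulr0 !addr0.
- by rewrite (mom_odd e 1) // !(mul0r, mulr0, addr0).
- by rewrite (_ : 2 ^_ 2 = 2)%N // !mul0r !mulr0 !addr0; ring.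
- by rewrite (mom_odd e 3) // (mom_odd e (3 - 2)) // !mul0r !mulr0 !addr0.
- rewrite (_ : 4 ^_ 2 = 12)%N // (_ : 4 ^_ 4 = 24)%N // (_ : 4 ^_ 6 = 0)%N //.
  transitivity (12 * f 0 ^+ 2 * f 2 ^+ 2 + (psC 6^-1 * 24%:R) * f 0 ^+ 2 * bracket4).
    by rewrite inv6 /bracket4; ring.
  by rewrite !mul0r mulr0 addr0 !subnn; ring.
- by rewrite (mom_odd e 5) // (mom_odd e (5 - 2)) // (mom_odd e (5 - 4)) // !(mul0r, mulr0, addr0).
- rewrite (_ : 6 ^_ 2 = 30)%N // (_ : 6 ^_ 4 = 360)%N // (_ : 6 ^_ 6 = 720)%N //.
  transitivity (30 * f 0 ^+ 2 * f 2 * f 4 + (psC 6^-1 * 360%:R) * f 0 * bracket4 * f 2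
    + (psC 120^-1 * 720%:R) * bracket6 * f 0).
    by rewrite inv6' inv120 /bracket4 /bracket6; ring.
  by rewrite !subnn; ring.
Qed.

(* Gaussian integration by parts with its cumulant corrections: the Laplacian
   absorbs the whole Gaussian part. *)
Lemma theta_mpoly_pderiv P d : P \is d.-homog -> (d <= 6)%N ->
  d%:R * (f 0 ^+ 3 * Lam P) = f 0 ^+ 2 * f 2 * Lam (pderiv 2 P)
    + psC 6^-1 * f 0 * bracket4 * Lam (pderiv 4 P)
    + psC 120^-1 * bracket6 * Lam (pderiv 6 P).
Proof.
move=> homP led.
have lin k : Lam (pderiv k P) = \sum_(m <- msupp P) psC P@_m * Lam (pderiv k 'X_[m]).
  rewrite {1}[P]mpolyE {1}/pderiv.
  transitivity (Lam (\sum_(m <- msupp P) P@_m *: pderiv k 'X_[m])).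
    congr Lam; under eq_bigr do rewrite raddf_sum.
    rewrite exchange_big; apply: eq_bigr => m _; rewrite /pderiv scaler_sumr.
    by apply: eq_bigr => i _; rewrite /= mderivmZ.
  by rewrite theta_mpoly_sum; apply: eq_bigr => m _; rewrite theta_mpolyZ.
rewrite !lin [Lam P]/theta_mpoly !mulr_sumr -!big_split; apply: eq_big_seq => m mP /=.
(* The degree is the sum of the exponents [m i], so the recurrence can be applied to one variable at
   a time. *)
rewrite -(dhomog_mdeg P d m homP mP) mdegE natr_sum.
have lem i : (m i <= 6)%N.
  apply: leq_trans led; rewrite -(dhomog_mdeg P d m homP mP) mdegE.
  by rewrite (bigD1 i) //= leq_addr.
rewrite /pderiv mulr_suml !theta_mpoly_sum !mulr_sumr -!big_split; apply: eq_bigr => i _ /=.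
rewrite !theta_mpoly_mderivnX (bigD1 i) //=; set W := \prod_(j | _) _.
transitivity (psC P@_m * W * ((m i)%:R * (f 0 ^+ 3 * f (m i)))); first by ring.
by rewrite moment_recurrence //; ring.
Qed.

Lemma mom0_mulI s t : f 0 * s = f 0 * t -> s = t.
Proof. by case: (e); [apply: theta_odd_mulI | apply: theta_even_mulI]. Qed.

Lemma mom0_exprI k s t : f 0 ^+ k * s = f 0 ^+ k * t -> s = t.
Proof.
elim: k => [|k IH]; first by rewrite !mul1r.
by rewrite exprS -!mulrA => /mom0_mulI/IH.
Qed.

Lemma theta_harmonic2 P : P \is 2.-homog -> pderiv 2 P = 0 -> Lam P = 0.
Proof.
move=> homP harmP; have := theta_mpoly_pderiv P 2 homP isT.
rewrite harmP !(pderiv_eq0 P 2) // theta_mpoly0 !mulr0 !addr0.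
rewrite -[RHS](mulr0 2) => /ps_natI; rewrite -[RHS](mulr0 (f 0 ^+ 3)).
exact: mom0_exprI.
Qed.

(** Only the fourth cumulant remains, and its factor [pderiv 4 P] is a constant polynomial. *)
Lemma theta_harmonic4 P : P \is 4.-homog -> pderiv 2 P = 0 ->
  exists c, f 0 ^+ 2 * Lam P = psC c * (bracket4 * f 0 ^+ n).
Proof.
move=> homP harmP; have := theta_mpoly_pderiv P 4 homP isT.
rewrite harmP (pderiv_eq0 P 4 6) // theta_mpoly0 !mulr0 addr0 add0r.
rewrite (dhomog0_const (pderiv 4 P)) ?dhomog_pderiv //; set c := (pderiv 4 P)@_0.
rewrite theta_mpolyC => eqP4; exists (4^-1 * (6^-1 * c)).
apply: (ps_natI 3); apply: mom0_mulI.
transitivity (4 * (f 0 ^+ 3 * Lam P)); first by ring.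
rewrite {}eqP4 !rmorphM /=.
transitivity (psC 6^-1 * f 0 * bracket4 * (psC c * f 0 ^+ n) * (psC 4^-1 * 4%:R)); last by ring.
by rewrite -(rmorph_nat psC) -rmorphM mulVf ?pnatr_eq0 // rmorph1 mulr1.
Qed.

(** The term of the fourth cumulant drops out because [pderiv 4 P] is harmonic of degree 2. The
    constant [pderiv 6 P] stays visible, as it vanishes in the plane. *)
Lemma theta_harmonic6 P : P \is 6.-homog -> pderiv 2 P = 0 ->
  exists c, f 0 ^+ 3 * Lam P = psC (c * (pderiv 6 P)@_0) * (bracket6 * f 0 ^+ n).
Proof.
move=> homP harmP; have := theta_mpoly_pderiv P 6 homP isT.
rewrite harmP (theta_harmonic2 (pderiv 4 P)) ?dhomog_pderiv //; last first.
  by rewrite pderivC harmP /pderiv big1 // => i _; rewrite raddf0.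
rewrite theta_mpoly0 !mulr0 !add0r.
rewrite (dhomog0_const (pderiv 6 P)) ?dhomog_pderiv //; set c := (pderiv 6 P)@_0.
rewrite mcoeffC eqxx mulr1 theta_mpolyC => eqP6; exists (6^-1 * 120^-1).
apply: (ps_natI 5); rewrite {}eqP6 !rmorphM /=.
transitivity (psC 120^-1 * bracket6 * (psC c * f 0 ^+ n) * (psC 6^-1 * 6%:R)); last by ring.
by rewrite -(rmorph_nat psC) -rmorphM mulVf ?pnatr_eq0 // rmorph1 mulr1.
Qed.

End ThetaFunctional.

(** * Product formulas for the harmonic theta series *)

Section ThetaHarmonic.
Context {R : realFieldType}.
Local Notation A := (@mom R false 0).
Local Notation B := (@mom R true 0).

Lemma theta_even_harmonic4 n (P : {mpoly R[n]}) :
    P \is 4.-homog -> pderiv 2 P = 0 ->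
  exists c, theta_mpoly n false P = psC c * (A ^+ n * B ^+ 4 * (A ^+ 4 - B ^+ 4)).
Proof.
move=> homP /(theta_harmonic4 _ false P homP)[c cE]; exists (c * 2).
apply: (mom0_exprI false 2); rewrite cE /bracket4 theta_even_bracket4 rmorphM rmorph_nat.
by ring.
Qed.

Lemma theta_odd_harmonic4 n (P : {mpoly R[n]}) :
    P \is 4.-homog -> pderiv 2 P = 0 ->
  exists c, theta_mpoly n true P = psC c * (B ^+ n * A ^+ 4 * (A ^+ 4 - B ^+ 4)).
Proof.
move=> homP /(theta_harmonic4 _ true P homP)[c cE]; exists (c * - 2).
apply: (mom0_exprI true 2); rewrite cE /bracket4 theta_odd_bracket4.
by rewrite rmorphM rmorphN rmorph_nat; ring.
Qed.

Lemma theta_even_harmonic6 n (P : {mpoly R[n]}) :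
    P \is 6.-homog -> pderiv 2 P = 0 ->
  exists c, theta_mpoly n false P =
    psC c * (A ^+ n * B ^+ 4 * (A ^+ 4 - B ^+ 4) * (A ^+ 4 - 2 * B ^+ 4)).
Proof.
move=> homP /(theta_harmonic6 _ false P homP)[c cE]; exists (c * (pderiv 6 P)@_0 * 8).
apply: (mom0_exprI false 3); rewrite cE /bracket6 theta_even_bracket6 !rmorphM rmorph_nat.
by ring.
Qed.

Lemma theta_odd_harmonic6 n (P : {mpoly R[n]}) :
    P \is 6.-homog -> pderiv 2 P = 0 ->
  exists c, theta_mpoly n true P =
    psC c * (B ^+ n * A ^+ 4 * (A ^+ 4 - B ^+ 4) * (2 * A ^+ 4 - B ^+ 4)).
Proof.
move=> homP /(theta_harmonic6 _ true P homP)[c cE]; exists (c * (pderiv 6 P)@_0 * 8).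
apply: (mom0_exprI true 3); rewrite cE /bracket6 theta_odd_bracket6 !rmorphM rmorph_nat.
by ring.
Qed.

(** In two variables the second derivatives of a harmonic [P] are opposite, hence so are the sixth
    derivatives, and [pderiv 6 P = 0]. *)
Lemma theta_plane_harmonic6 e (P : {mpoly R[2]}) :
  P \is 6.-homog -> pderiv 2 P = 0 -> theta_mpoly 2 e P = 0.
Proof.
move=> homP harmP; have [c] := theta_harmonic6 _ e P homP harmP.
suff -> : pderiv 6 P = 0.
  rewrite mcoeff0 mulr0 rmorph0 mul0r -[RHS](mulr0 (mom e 0 ^+ 3)).
  exact: mom0_exprI.
have two (F : 'I_2 -> {mpoly R[2]}) : \sum_i F i = F ord0 + F ord_max.
  by rewrite big_ord_recl big_ord1; congr (_ + F _); apply: val_inj.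
have swap : P^`M(ord0, 2) = - P^`M(ord_max, 2).
  by apply/eqP; rewrite -addr_eq0; apply/eqP; rewrite -harmP /pderiv two.
have split6 (i : 'I_2) Q : Q^`M(i, 6) = Q^`M(i, 2)^`M(i, 2)^`M(i, 2).
  rewrite -!mderivmDm; congr (_^`M[_]); apply/mnmP => j.
  by rewrite !(mulmnE, mnmDE); lia.
have comm2 (Q : {mpoly R[2]}) : Q^`M(ord_max, 2)^`M(ord0, 2) = Q^`M(ord0, 2)^`M(ord_max, 2).
  by rewrite -!mderivmDm addmC.
have neg (i : 'I_2) (Q : {mpoly R[2]}) : (- Q)^`M(i, 2) = - Q^`M(i, 2).
  exact: raddfN.
pose Q := P^`M(ord_max, 2).
have Q0 : Q^`M(ord0, 2) = - Q^`M(ord_max, 2) by rewrite /Q comm2 swap neg.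
have Q00 : Q^`M(ord0, 2)^`M(ord0, 2) = Q^`M(ord_max, 2)^`M(ord_max, 2).
  by rewrite Q0 neg comm2 Q0 neg opprK.
by rewrite /pderiv two !split6 swap -/Q !neg Q00 addNr.
Qed.

End ThetaHarmonic.

(** * Lagrange's four-square theorem *)

Definition sum4sq (n : int) : Prop :=
  exists a b c d : int, n = a ^+ 2 + b ^+ 2 + c ^+ 2 + d ^+ 2.

(** Euler's identity, the multiplicativity of the quaternion norm with one factor conjugated. *)
Lemma sum4sqM m n : sum4sq m -> sum4sq n -> sum4sq (m * n).
Proof.
move=> [a [b [c [d ->]]]] [a' [b' [c' [d' ->]]]].
exists (a * a' + b * b' + c * c' + d * d'), (a * b' - b * a' + c * d' - d * c').
exists (a * c' - c * a' + d * b' - b * d'), (a * d' - d * a' + b * c' - c * b').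
by ring.
Qed.

Lemma centered_edivz (a m : int) : 0 < m ->
  exists b k : int, a = b + m * k /\ - m <= 2 * b <= m.
Proof.
move=> m0; have rm := ltz_pmod a m0; have r0 := modz_ge0 a (lt0r_neq0 m0).
have := divz_eq a m; move: (a %/ m)%Z (a %% m)%Z rm r0 => q r rm r0 ->.
have [le2r|gt2r] := leP (2 * r) m.
  by exists r, q; split; [ring | lia].
by exists (r - m), (q + 1); split; [ring | lia].
Qed.

(** Pigeonhole: for arguments from 0 to [h = (p - 1) / 2] the residues of [y ^ 2], and likewise
    those of [- 1 - y ^ 2], are [h + 1] distinct ones, and together these exceed [p]. *)
Lemma dvdn_two_squares1 p : prime p -> odd p ->
  exists x y m : nat, [/\ (x ^ 2 + y ^ 2 + 1 = m * p)%N, (0 < m)%N & (m < p)%N].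
Proof.
move=> p_pr oddp; set h := p./2.
have pE : p = h.*2.+1 by rewrite -[LHS]odd_double_half oddp.
have h0 : (0 < h)%N by have := prime_gt1 p_pr; rewrite pE; lia.
pose s := [seq (x ^ 2 %% p)%N | x <- iota 0 h.+1].
have s_uniq : uniq s.
  rewrite map_inj_in_uniq ?iota_uniq // => x y; rewrite !mem_iota !add0n /= => lex ley exy.
  wlog lexy : x y lex ley exy / (x <= y)%N.
    by case: (leqP x y) => [|/ltnW] le W; [exact: W | apply/esym; apply: W].
  have : (p %| y ^ 2 - x ^ 2)%N by rewrite -eqn_mod_dvd ?exy // leq_exp2r.
  rewrite subn_sqr Euclid_dvdM // => /orP[] /dvdn_leq; lia.
have lt_s z : z \in s -> (z < p)%N.
  by move=> /mapP[x _ ->]; rewrite ltn_mod prime_gt0.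
pose t := [seq (p.-1 - z)%N | z <- s].
have t_uniq : uniq t.
  rewrite map_inj_in_uniq // => y z /lt_s ly /lt_s lz; lia.
have /allPn[_ /mapP[z zs ->]] : ~~ all (fun z => z \notin s) t.
  apply/negP => /allP st.
  have : (size (s ++ t) <= size (iota 0 p))%N.
    apply: uniq_leq_size => [|z].
      by rewrite cat_uniq s_uniq t_uniq andbT; apply/hasPn.
    rewrite mem_cat mem_iota add0n => /orP[/lt_s//|/mapP[y /lt_s ly ->]] /=; lia.
  by rewrite size_cat /t /s !size_map !size_iota pE; lia.
rewrite negbK => /mapP[x]; rewrite mem_iota add0n => /= lex ex.
have lz := lt_s z zs; move: zs => /mapP[y]; rewrite mem_iota add0n => /= ley ey.
have : (p %| x ^ 2 + y ^ 2 + 1)%N.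
  rewrite (divn_eq (x ^ 2) p) (divn_eq (y ^ 2) p) -ey -ex.
  have -> : (x ^ 2 %/ p * p + (p.-1 - z) + (y ^ 2 %/ p * p + z) + 1
    = (x ^ 2 %/ p + y ^ 2 %/ p + 1) * p)%N by rewrite !mulnDl; lia.
  exact: dvdn_mull.
move=> /dvdnP[m mE]; exists x, y, m; split=> //; first by case: m mE => //; lia.
(* Both squares are at most [h ^ 2], so [m * p < p ^ 2]. *)
have : (x ^ 2 <= h ^ 2)%N by rewrite leq_exp2r.
have : (y ^ 2 <= h ^ 2)%N by rewrite leq_exp2r.
rewrite -(ltn_pmul2r (prime_gt0 p_pr)) -mE pE; nia.
Qed.

(* Euler's identity applied to [a] and to its centered residue [b] modulo [m]
   produces four multiples of [m]. *)
Lemma sum4sq_descent (p m : nat) : prime p -> (1 < m)%N -> (m < p)%N ->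
  sum4sq (m%:Z * p%:Z) ->
  exists r : nat, [/\ (0 < r)%N, (r < m)%N & sum4sq (r%:Z * p%:Z)].
Proof.
move=> p_pr m1 mp [a1 [a2 [a3 [a4 aE]]]].
have m0 : 0 < m%:Z :> int by lia.
have ndvd (k : int) : p%:Z = m%:Z * k -> False.
  move=> pk; have : (m %| p)%N by apply/dvdnP; exists `|k|%N; lia.
  by move=> /(prime_nt_dvdP p_pr) ?; lia.
have [b1 [k1 [a1E b1m]]] := centered_edivz a1 _ m0.
have [b2 [k2 [a2E b2m]]] := centered_edivz a2 _ m0.
have [b3 [k3 [a3E b3m]]] := centered_edivz a3 _ m0.
have [b4 [k4 [a4E b4m]]] := centered_edivz a4 _ m0.
(* The quotient by [m] of the sum of the [b ^ 2], found by expanding [a = b + m * k] in [aE]. *)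
pose r := p%:Z - 2 * (b1 * k1 + b2 * k2 + b3 * k3 + b4 * k4)
  - m%:Z * (k1 ^+ 2 + k2 ^+ 2 + k3 ^+ 2 + k4 ^+ 2).
have bE : b1 ^+ 2 + b2 ^+ 2 + b3 ^+ 2 + b4 ^+ 2 = m%:Z * r.
  by rewrite /r !mulrBr aE a1E a2E a3E a4E; ring.
have sq_le (b : int) : - m%:Z <= 2 * b <= m%:Z -> 4 * b ^+ 2 <= m%:Z ^+ 2.
  move=> bm; rewrite -subr_ge0.
  have -> : m%:Z ^+ 2 - 4 * b ^+ 2 = (m%:Z - 2 * b) * (m%:Z + 2 * b) by ring.
  by apply: mulr_ge0; clear -bm; lia.
have r_le : r <= m%:Z.
  rewrite -(ler_pM2l m0) -bE.
  have := sq_le _ b1m; have := sq_le _ b2m; have := sq_le _ b3m; have := sq_le _ b4m.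
  rewrite -expr2; move: (b1 ^+ 2) (b2 ^+ 2) (b3 ^+ 2) (b4 ^+ 2) (m%:Z ^+ 2); clear.
  by lia.
have r_ge0 : 0 <= r by rewrite -(ler_pM2l m0) mulr0 -bE !addr_ge0 ?sqr_ge0.
(* If [r = 0], all residues vanish and [m] divides [p]. *)
have r_neq0 : r != 0.
  apply/eqP => r0; rewrite r0 mulr0 in bE.
  have [b10 b20 b30 b40] : [/\ b1 = 0, b2 = 0, b3 = 0 & b4 = 0].
    move/eqP: bE; rewrite !paddr_eq0 ?addr_ge0 ?sqr_ge0 // !sqrf_eq0.
    by move=> /andP[/andP[/andP[/eqP-> /eqP->] /eqP->] /eqP->].
  apply: (ndvd (k1 ^+ 2 + k2 ^+ 2 + k3 ^+ 2 + k4 ^+ 2)).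
  by move: r0; rewrite /r b10 b20 b30 b40 => /eqP; rewrite subr_eq0 => /eqP <-; ring.
(* If [r = m], every bound [4 * b ^ 2 <= m ^ 2] is attained, so each [2 * b] is [m] or [- m], and
   again [m] divides [p]. *)
have r_neqm : r != m%:Z.
  apply/eqP => rm; rewrite rm in bE.
  have eq_m (b : int) : 4 * b ^+ 2 = m%:Z ^+ 2 ->
      exists s : int, 2 * b = m%:Z * s.
    move=> e4; have : (2 * b - m%:Z) * (2 * b + m%:Z) = 0.
      by rewrite -subr_sqr exprMn -e4; ring.
    move/eqP; rewrite mulf_eq0 subr_eq0 addr_eq0 => /orP[] /eqP ->.
      by exists 1; ring.
    by exists (-1); ring.
  have l1 := sq_le _ b1m; have l2 := sq_le _ b2m; have l3 := sq_le _ b3m; have l4 := sq_le _ b4m.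
  rewrite -expr2 in bE.
  have [/eq_m[s1 e1] /eq_m[s2 e2] /eq_m[s3 e3] /eq_m[s4 e4]] :
      [/\ 4 * b1 ^+ 2 = m%:Z ^+ 2, 4 * b2 ^+ 2 = m%:Z ^+ 2,
          4 * b3 ^+ 2 = m%:Z ^+ 2 & 4 * b4 ^+ 2 = m%:Z ^+ 2].
    move: bE l1 l2 l3 l4.
    move: (b1 ^+ 2) (b2 ^+ 2) (b3 ^+ 2) (b4 ^+ 2) (m%:Z ^+ 2); clear.
    by split; lia.
  apply: (ndvd (1 + s1 * k1 + s2 * k2 + s3 * k3 + s4 * k4
    + k1 ^+ 2 + k2 ^+ 2 + k3 ^+ 2 + k4 ^+ 2)).
  have -> : p%:Z = r + 2 * b1 * k1 + 2 * b2 * k2 + 2 * b3 * k3 + 2 * b4 * k4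
    + m%:Z * (k1 ^+ 2 + k2 ^+ 2 + k3 ^+ 2 + k4 ^+ 2) by rewrite /r; ring.
  by rewrite e1 e2 e3 e4 rm; ring.
exists `|r|%N; split; [by clear -r_neq0; lia | by clear -r_le r_ge0 r_neqm; lia |].
rewrite (gez0_abs r_ge0).
(* The four integers of Euler's identity for [a] and [b], already divided by [m]. *)
exists (r + k1 * b1 + k2 * b2 + k3 * b3 + k4 * b4), (k1 * b2 - k2 * b1 + k3 * b4 - k4 * b3).
exists (k1 * b3 - k3 * b1 + k4 * b2 - k2 * b4), (k1 * b4 - k4 * b1 + k2 * b3 - k3 * b2).
have mm0 : m%:Z ^+ 2 != 0 :> int by rewrite expf_neq0 //; lia.
apply: (mulfI mm0).
transitivity ((m%:Z * p%:Z) * (m%:Z * r)); first by ring.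
rewrite -bE aE a1E a2E a3E a4E.
transitivity ((m%:Z * r + m%:Z * (k1 * b1 + k2 * b2 + k3 * b3 + k4 * b4)) ^+ 2
  + m%:Z ^+ 2 * ((k1 * b2 - k2 * b1 + k3 * b4 - k4 * b3) ^+ 2
  + (k1 * b3 - k3 * b1 + k4 * b2 - k2 * b4) ^+ 2
  + (k1 * b4 - k4 * b1 + k2 * b3 - k3 * b2) ^+ 2)); last by ring.
by rewrite -bE; ring.
Qed.

Lemma sum4sq_prime p : prime p -> sum4sq p%:Z.
Proof.
move=> p_pr; have [/eqP p2|oddp] := boolP (p == 2%N).
  by exists 1, 1, 0, 0; rewrite p2.
have {}oddp : odd p by case: (even_prime p_pr) oddp => [->|].
have [x [y [m [mE m0 mp]]]] := dvdn_two_squares1 p p_pr oddp.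
have : sum4sq (m%:Z * p%:Z).
  by exists x%:Z, y%:Z, 1, 0; rewrite -PoszM -mE; lia.
elim/ltn_ind: m m0 mp {mE} => m IH m0 mp sm.
have [m1|m1] := leqP m 1.
  have m1E : m = 1%N by lia.
  by rewrite m1E mul1r in sm.
have [r [r0 rm sr]] := sum4sq_descent p m p_pr m1 mp sm.
by apply: (IH r) => //; apply: ltn_trans mp.
Qed.

Theorem four_squares n : sum4sq n%:Z.
Proof.
elim/ltn_ind: n => -[|[|n]] IH; [by exists 0, 0, 0, 0 | by exists 1, 0, 0, 0 |].
set N := n.+2 in IH *; have p_pr : prime (pdiv N) by exact: pdiv_prime.
have /dvdnP[k NE] := pdiv_dvd N.
have -> : N%:Z = k%:Z * (pdiv N)%:Z by rewrite -PoszM -NE.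
apply: sum4sqM; last exact: sum4sq_prime.
apply: IH; move: (prime_gt1 p_pr) NE; move: (pdiv N) => q q1 NE.
by rewrite NE ltn_Pmulr //; case: k NE.
Qed.

(** * Shells *)

Section Shells.
Context {R : realType}.
Implicit Types (m : R) (e : bool).

Definition half_row n e B (k : {ffun 'I_n -> 'I_(win_size e B)}) : 'rV[R]_n :=
  \row_i ((win_elt e B (k i))%:~R / 2).

(** A common form of [shellZ] and [shellSh]: halves of integer vectors whose coordinates have parity
    [e]. *)
Definition shell e n m : seq 'rV[R]_n :=
  let B := box_bound m in
  [seq x <- [seq half_row n e B k | k : {ffun 'I_n -> 'I_(win_size e B)}]
     | sqnorm x == m].

Lemma win_elt_half e B (j : nat) :
  (win_elt e B j)%:~R / 2 = j%:R - B%:R - e%:R / 2 :> R.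
Proof.
rewrite /win_elt rmorphB /= -[_%:~R]/(_%:R) -[(B.*2 + e)%:~R]/(_%:R).
by rewrite natrD -!muln2 !natrM; field.
Qed.

Lemma shellZE n m : shellZ n m = shell false n m.
Proof.
congr filter; apply: eq_map => k; apply/rowP => i.
by rewrite !mxE win_elt_half mul0r subr0.
Qed.

Lemma shellShE n m : shellSh n m = shell true n m.
Proof.
congr filter; apply: eq_map => k; apply/rowP => i.
by rewrite !mxE win_elt_half mul1r.
Qed.

Lemma sqnorm_half_row n e B k :
  4 * sqnorm (half_row n e B k) = (\sum_i `|win_elt e B (k i)| ^ 2)%N%:R.
Proof.
rewrite /sqnorm mulr_sumr natr_sum; apply: eq_bigr => i _; rewrite mxE natrX natr_absz.
by rewrite intr_norm real_normK ?num_real // exprMn; field.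
Qed.

(** With [B] for the box bound, [m < B] and [1 <= B] give [N < 4 * B <= (2 * B) ^ 2]. *)
Lemma box_bound_norm m N : 4 * m = N%:R -> (N <= (box_bound m).*2 ^ 2)%N.
Proof.
move=> mN; have : (N < 4 * box_bound m)%N.
  by rewrite -(ltr_nat R) -mN natrM ltr_pM2l // /box_bound truncnS_gt.
by rewrite /box_bound; nia.
Qed.

Lemma meval_homog n (P : {mpoly R[n]}) d c (v : 'I_n -> R) : P \is d.-homog ->
  P.@[fun i => c * v i] = c ^+ d * P.@[v].
Proof.
move=> homP; rewrite !mevalE mulr_sumr; apply: eq_big_seq => u uP.
rewrite -(dhomog_mdeg P d u homP uP) mdegE mulrCA; congr (_ * _).
by under eq_bigr do rewrite exprMn; rewrite big_split prodrXr.
Qed.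

(** Doubling the coordinates moves norm [m] to exponent [4 * m] and multiplies a form of degree [d]
    by [2 ^ d]. *)
Lemma psc_theta_shell e n m N d (P : {mpoly R[n]}) : 4 * m = N%:R -> P \is d.-homog ->
  psc (theta_mpoly n e P) N = 2 ^+ d * \sum_(x <- shell e n m) evalp P x.
Proof.
move=> mN homP; have leN := box_bound_norm m N mN.
rewrite /shell; move: (box_bound m) leN => B leN.
rewrite big_filter big_map big_enum_cond /= mulr_sumr psc_sum.
under eq_bigr do rewrite pscCM (psc_prod_mom n e _ B N leN) mulr_sumr.
rewrite exchange_big; apply: eq_big => [k|k _].
  by rewrite -(inj_eq (mulfI (_ : 4 != 0 :> R))) ?pnatr_eq0 // sqnorm_half_row mN eqr_nat.
rewrite /evalp -meval_homog // mevalE; apply: eq_bigr => u _; congr (_ * _).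
by apply: eq_bigr => i _; rewrite mxE mulrCA divff ?pnatr_eq0 // mulr1.
Qed.

(** The norm [m] is an arbitrary real, but a nonempty shell has an exponent in the theta series. *)
Lemma shell_norm e n m : shell e n m != [::] -> exists N : nat, 4 * m = N%:R.
Proof.
case E: (shell e n m) => [//|x s] _.
have : x \in shell e n m by rewrite E mem_head.
rewrite mem_filter => /andP[/eqP <- /mapP[k _ ->]].
by rewrite sqnorm_half_row; eexists.
Qed.

Lemma harmonic_pderiv n (P : {mpoly R[n]}) : harmonic P -> pderiv 2 P = 0.
Proof.
by move=> /eqP <-; apply: eq_bigr => i _; rewrite mderivn_iter.
Qed.

Lemma cond_C_shell e n m N d : 4 * m = N%:R ->
    (forall P : {mpoly R[n]}, P \is d.-homog -> pderiv 2 P = 0 ->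
       psc (theta_mpoly n e P) N = 0) ->
  cond_C (shell e n m) d.
Proof.
move=> mN vanish P homP /harmonic_pderiv/(vanish P homP).
rewrite (psc_theta_shell e n m N d) // => /eqP.
by rewrite mulf_eq0 expf_eq0 pnatr_eq0 andbF => /eqP.
Qed.

Lemma cond_C_shell_all e n m d :
    (forall P : {mpoly R[n]}, P \is d.-homog -> pderiv 2 P = 0 -> theta_mpoly n e P = 0) ->
  cond_C (shell e n m) d.
Proof.
move=> vanish; have [->|/shell_norm[N mN]] := eqVneq (shell e n m) [::].
  by move=> P _ _; rewrite big_nil.
by apply: (cond_C_shell _ _ _ N) => // P homP harmP; rewrite vanish // psc0.
Qed.

Lemma cond_C2_shell e n m : cond_C (shell e n m) 2.
Proof. by apply: cond_C_shell_all => P homP harmP; apply: theta_harmonic2. Qed.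

Lemma sph_design3_shell e n m : shell e n m != [::] -> sph_design (shell e n m) 3.
Proof.
by move=> nz; split=> // -[|[|j]] // _ _; apply: cond_C2_shell.
Qed.

Lemma sph_design_half_shell e n m : shell e n m != [::] -> cond_C (shell e n m) 6 ->
  sph_design_half (shell e n m) 1.
Proof.
by move=> nz C6; split=> //; split=> // -[|[|j]] // _ _; apply: cond_C2_shell.
Qed.

Lemma sph_design5_shell e n m : shell e n m != [::] -> cond_C (shell e n m) 4 ->
  sph_design (shell e n m) 5.
Proof.
by move=> nz C4; split=> // -[|[|[|j]]] // _ _; apply: cond_C2_shell.
Qed.

(** The list [s] holds the doubled coordinates of a point; each entry lies in the window since its
    square is at most [N]. *)
Lemma shell_neq_nil e n m (s : seq int) : size s = n ->
    all (fun y => odd `|y| == e) s -> 4 * m = (\sum_(y <- s) y ^+ 2)%:~R ->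
  shell e n m != [::].
Proof.
move=> sz_s odd_s mE; pose N := (\sum_(y <- s) `|y| ^ 2)%N.
have mN : 4 * m = N%:R.
  rewrite mE rmorph_sum natr_sum; apply: eq_bigr => y _ /=.
  by rewrite natrX natr_absz intr_norm real_normK ?num_real // rmorphXn.
have leN := box_bound_norm m N mN; set B := box_bound m in leN.
have idx (i : 'I_n) : exists k : 'I_(win_size e B), win_elt e B k = s`_i.
  set y := s`_i; have ys : y \in s by rewrite mem_nth // sz_s.
  have : y \in win e B.
    rewrite mem_win (allP odd_s _ ys) andbT.
    have le_sq : (`|y| ^ 2 <= B.*2 ^ 2)%N.
      by apply: leq_trans leN; rewrite /N (big_rem _ ys) leq_addr.
    by rewrite leq_exp2r // in le_sq; lia.
  case/mapP => k; rewrite mem_iota add0n => ltk ->.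
  by exists (Ordinal ltk).
have [k kE] := fin_all_exists idx.
have xk : half_row n e B [ffun i => k i] \in shell e n m.
  rewrite mem_filter map_f ?mem_enum // andbT.
  rewrite -(inj_eq (mulfI (_ : 4 != 0 :> R))) ?pnatr_eq0 // sqnorm_half_row mN.
  apply/eqP; congr _%:R; rewrite /N (big_nth 0) sz_s big_mkord.
  by apply: eq_bigr => i _; rewrite ffunE kE.
by apply: contraTneq xk => ->.
Qed.

Lemma shellZ_neq_nil n (N : nat) : (4 <= n)%N -> shell false n (N%:R : R) != [::].
Proof.
move=> n4; have [a [b [c [d NE]]]] := four_squares N.
apply: (shell_neq_nil _ _ _ ([:: 2 * a; 2 * b; 2 * c; 2 * d] ++ nseq (n - 4) 0)).
- by rewrite size_cat size_nseq /=; lia.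
- by rewrite all_cat all_nseq orbT /= !abszM !oddM.
rewrite big_cat !big_cons big_nil big_nseq iter_addr_0 expr0n mul0rn /=.
rewrite -[N%:R]/((N%:Z)%:~R) NE -[4]/(4%:~R) -rmorphM; congr _%:~R; ring.
Qed.

(* [(2 a + 1) ^ 2 + (2 a - 1) ^ 2 = 8 a ^ 2 + 2] *)
Lemma shellSh16_neq_nil m (N : nat) : 4 * m = (8 * N + 16)%:R -> shell true 16 m != [::].
Proof.
move=> mN; have [a [b [c [d NE]]]] := four_squares N.
apply: (shell_neq_nil _ _ _ ([:: 2 * a + 1; 2 * a - 1; 2 * b + 1; 2 * b - 1;
  2 * c + 1; 2 * c - 1; 2 * d + 1; 2 * d - 1] ++ nseq 8 1)) => //.
  rewrite all_cat all_nseq orbT andbT /=; clear; lia.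
rewrite mN big_cat !big_cons !big_nil /=.
rewrite natrD natrM -[N%:R]/((N%:Z)%:~R) NE -[8%:R]/(8%:~R) -[16%:R]/(16%:~R).
by rewrite -rmorphM -rmorphD; congr _%:~R; ring.
Qed.

End Shells.

Theorem theorem9p2 (R : realType) :
  (* (i) *)
  (forall (n : nat) (m : R), (2 <= n)%N ->
     (shellZ n m != [::] -> sph_design (shellZ n m) 3) /\
     (shellSh n m != [::] -> sph_design (shellSh n m) 3)) /\
  (* (ii): 3 1/2-designs, i.e. s = 1 *)
  ((forall m : R, shellZ 2 m != [::] -> sph_design_half (shellZ 2 m) 1) /\
   (forall m : R, shellSh 2 m != [::] -> sph_design_half (shellSh 2 m) 1) /\
   (forall a : nat, sph_design_half (shellZ 16 (2 * 4 ^+ a : R)) 1) /\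
   (forall a : nat, (1 <= a)%N -> sph_design_half (shellSh 16 (2 * 4 ^+ a : R)) 1) /\
   sph_design_half (shellSh 40 (24 : R)) 1) /\
  (* (iii) *)
  ((forall a : nat, (1 <= a)%N -> sph_design (shellZ 4 (2 * a%:R : R)) 5) /\
   (forall a b : nat, sph_design (shellZ 7 (4 ^+ a * (8 * b%:R + 3) : R)) 5) /\
   (forall a : nat, (1 <= a)%N -> sph_design (shellSh 16 (4 * a%:R + 2 : R)) 5)).
Proof.
split=> [n m _|].
  by rewrite shellZE shellShE; split; apply: sph_design3_shell.
have plane e m : shell e 2 m != [::] -> sph_design_half (shell e 2 m) 1.
  move=> nz; apply: sph_design_half_shell => //.
  by apply: cond_C_shell_all => P; apply: theta_plane_harmonic6.
split; [split; [|split; [|split; [|split]]] | split; [|split]].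
- by move=> m; rewrite shellZE; apply: plane.
- by move=> m; rewrite shellShE; apply: plane.
- move=> a; rewrite shellZE; apply: sph_design_half_shell.
    by rewrite -natrX -natrM shellZ_neq_nil.
  apply: (cond_C_shell _ _ _ (8 * 4 ^ a)); first by rewrite natrM natrX; ring.
  move=> P homP harmP; have [c ->] := theta_even_harmonic6 _ P homP harmP.
  by rewrite pscCM psc_harmonic6_Z16 mulr0.
- move=> a a1; rewrite shellShE; apply: sph_design_half_shell.
    (* The truncated subtraction is exact because [a >= 1]. *)
    apply: (shellSh16_neq_nil _ (4 ^ a - 2)).
    have -> : (8 * (4 ^ a - 2) + 16 = 8 * 4 ^ a)%N.
      by case: a a1 => // a _; rewrite expnS; have := expn_gt0 4 a; lia.
    by rewrite natrM natrX; ring.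
  apply: (cond_C_shell _ _ _ (8 * 4 ^ a)); first by rewrite natrM natrX; ring.
  move=> P homP harmP; have [c ->] := theta_odd_harmonic6 _ P homP harmP.
  by rewrite pscCM psc_harmonic6_Sh16 mulr0.
- rewrite shellShE; apply: sph_design_half_shell.
    (* [7 * 9 + 33 * 1 = 96 = 4 * 24]. *)
    apply: (shell_neq_nil _ _ _ (nseq 7 3 ++ nseq 33 1)) => //.
    by rewrite big_cat !big_nseq !iter_addr_0 -natrM.
  apply: (cond_C_shell _ _ _ 96); first by rewrite -natrM.
  move=> P homP harmP; have [c ->] := theta_odd_harmonic6 _ P homP harmP.
  by rewrite pscCM psc_harmonic6_Sh40 mulr0.
- move=> a a1; rewrite shellZE; apply: sph_design5_shell.
    by rewrite -natrM shellZ_neq_nil.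
  apply: (cond_C_shell _ _ _ (8 * a)); first by rewrite natrM; ring.
  move=> P homP harmP; have [c ->] := theta_even_harmonic4 _ P homP harmP.
  by rewrite pscCM (supp_psc0 _ _ _ _ supp_harmonic4_Z4) ?mulr0 //; lia.
- move=> a b; rewrite shellZE; apply: sph_design5_shell.
    by rewrite -natrM -natrD -natrX -natrM shellZ_neq_nil.
  apply: (cond_C_shell _ _ _ (4 ^ a * (32 * b + 12))).
    by rewrite natrM natrX natrD natrM; ring.
  move=> P homP harmP; have [c ->] := theta_even_harmonic4 _ P homP harmP.
  by rewrite pscCM psc_harmonic4_Z7 mulr0.
- move=> a a1; rewrite shellShE; apply: sph_design5_shell.
    (* Solves [8 * N + 16 = 16 * a + 8]; [a >= 1] makes the subtraction exact. *)
    apply: (shellSh16_neq_nil _ (2 * a - 1)).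
    have -> : (8 * (2 * a - 1) + 16 = 16 * a + 8)%N by lia.
    by rewrite natrD natrM; ring.
  apply: (cond_C_shell _ _ _ (16 * a + 8)); first by rewrite natrD natrM; ring.
  move=> P homP harmP; have [c ->] := theta_odd_harmonic4 _ P homP harmP.
  by rewrite pscCM (supp_psc0 _ _ _ _ supp_harmonic4_Sh16) ?mulr0 //; lia.
Qed.
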